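(* Let $d\ge 1$ and $p\in(0,1)$, and consider the $d$-dimensional East model on $\mathbb{Z}^d$ with parameter $p$. For any probability measure $\nu$ on $\{0,1\}^{\mathbb{Z}^d}$ satisfying Condition $(\mathcal{C})$, there exist constants $\chi=\chi(p)>0$, $c_1=c_1(p,\nu)>0$ and $C_1=C_1(p,\nu)>0$ such that for every $t\ge 0$ and every function $f:\{0,1\}^{\mathbb{Z}^d}\to\mathbb{R}$ with $\mathrm{supp}(f)\subset\Lambda(\chi t^{1/d})$, \[ \int_{\{0,1\}^{\mathbb{Z}^d}}\left|\mathbb{E}_\eta(f(\eta_t))-\mu(f)\right|\,\mathrm{d}\nu(\eta)\le C_1\|f\|_\infty e^{-c_1 t}. \]
   Context: Let $e_1,\dots,e_d$ be the canonical basis of $\mathbb{R}^d$ and $p\in(0,1)$. The East model on $\mathbb{Z}^d$ is the following continuous-time process $(\eta_t)_{t\ge0}$ on $\{0,1\}^{\mathbb{Z}^d}$: independently for each site $x\in\mathbb{Z}^d$, let $(B_{x,n})_{n\ge1}$ be i.i.d. Bernoulli$(p)$ variables and $0=t_{x,0}<t_{x,1}<t_{x,2}<\dots$ times whose increments $t_{x,n}-t_{x,n-1}$ are i.i.d. exponential of parameter 1, independent of the $B$'s. At time $t_{x,n}$, if there exists $i\in\{1,\dots,d\}$ with $\eta_{t_{x,n}}(x-e_i)=0$ (state just before the time $t_{x,n}$), the spin at $x$ is replaced by $B_{x,n}$ (an ''update at $x$''); otherwise nothing happens. $\mathbb{P}_\eta,\mathbb{E}_\eta$ denote law and expectation of the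 process started from $\eta$. $\mu$ is the product Bernoulli$(p)$ measure on $\{0,1\}^{\mathbb{Z}^d}$ and $\mu(f)$ the expectation of $f$ under $\mu$. For $f:\{0,1\}^{\mathbb{Z}^d}\to\mathbb{R}$ and $\Lambda'\subset\mathbb{Z}^d$, $\mathrm{supp}(f)\subset\Lambda'$ means $f(\eta)=f(\eta')$ whenever $\eta,\eta'$ coincide on $\Lambda'$; $\|f\|_\infty=\sup_\eta|f(\eta)|$. For $r\ge0$, $\Lambda(r)=\left(\prod_{i=1}^d\{0,\dots,\lfloor r\rfloor\}\right)\setminus\{(0,\dots,0)\}$. A measure $\nu$ on $\{0,1\}^{\mathbb{Z}^d}$ satisfies Condition $(\mathcal{C})$ if there exist $a,A>0$ such that for all $\ell\ge0$, $\nu\left(\forall x\in\{-\lfloor\ell\rfloor,\dots,0\}^d,\ \eta(x)=1\right)\le Ae^{-a\ell}$. *)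

(* Defs.v *)
From HB Require Import structures.
From mathcomp Require Import all_boot all_order all_algebra.
From mathcomp Require Import all_classical all_reals all_analysis.
Set Implicit Arguments. Unset Strict Implicit. Unset Printing Implicit Defensive.
Import Order.TTheory GRing.Theory Num.Theory.
Local Open Scope classical_set_scope.
Local Open Scope ring_scope.

(** Sites of Z^d, configurations {0,1}^{Z^d} (true = 1, false = 0). *)
Definition site (d : nat) := {ffun 'I_d -> int}.

Definition ebasis (d : nat) (i : 'I_d) : site d := [ffun j => ((j == i) : nat)%:Z].
Definition site_sub_e (d : nat) (x : site d) (i : 'I_d) : site d :=
  [ffun j => x j - ((j == i) : nat)%:Z].

Definition rawconfig (d : nat) := site d -> bool.

Definition cylinders (d : nat) : set (set (rawconfig d)) :=
  fun A => exists (x : site d) (b : bool), A = [set eta | eta x = b].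

Definition config (d : nat) := g_sigma_algebraType (@cylinders d).

Definition supp_in (d : nat) (R : Type) (f : config d -> R) (L : set (site d)) :=
  forall eta eta' : config d, (forall x, L x -> eta x = eta' x) -> f eta = f eta'.

Definition Lambda (R : realType) (d : nat) (r : R) : set (site d) :=
  fun x => (forall i, (0 <= x i)%R /\ (x i <= Num.floor r)%R) /\ x <> [ffun _ => 0%R].

Definition supnorm (R : realType) (d : nat) (f : config d -> R) : R :=
  sup [set `|f eta| | eta in [set: config d]].

Definition condition_C (R : realType) (d : nat) (nu : probability (config d) R) :=
  exists a A : R, 0 < a /\ 0 < A /\
    forall l : R, 0 <= l ->
      (nu [set eta : config d | forall x : site d,
             (forall i, (- Num.floor l <= x i)%R /\ (x i <= 0)%R) -> eta x = true]
       <= (A * expR (- (a * l)))%:E)%E.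

Definition product_bernoulli (R : realType) (d : nat) (p : R)
    (mu : probability (config d) R) :=
  forall (s : seq (site d)) (b : site d -> bool), uniq s ->
    mu [set eta : config d | forall x, x \in s -> eta x = b x] =
    (\prod_(x <- s) (if b x then p else 1 - p))%:E.

Definition mutually_independent (dO : measure_display) (O : measurableType dO)
    (R : realType) (P : probability O R) (I : eqType) (X : I -> O -> R) :=
  (forall i, measurable_fun setT (X i)) /\
  forall (s : seq I) (A : I -> set R), uniq s ->
    (forall i, measurable (A i)) ->
    P (\bigcap_(i in [set j | j \in s]) (X i @^-1` A i)) =
    \big[*%E/1%E]_(i <- s) P (X i @^-1` A i).

(** clock times t_{x,n} = sum_{k<n} tau x k  (tau x k is the (k+1)-th increment) *)
Definition clock (R : realType) (d : nat) (tau : site d -> nat -> R) (x : site d) (n : nat) : R :=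
  \sum_(k < n) tau x k.

Definition left_value (R : realType) (d : nat) (e : R -> config d) (y : site d) (t : R) (b : bool) :=
  exists eps : R, 0 < eps /\ forall s, t - eps < s -> s < t -> e s y = b.

(** trajectory e (defined for times >= 0) of the East model started from zeta,
    driven by clock increments tau and coins B (B x n is used at the (n+1)-th ring
    of the clock at x, i.e. at time clock tau x n.+1). *)
Definition east_trajectory (R : realType) (d : nat) (tau : site d -> nat -> R)
    (B : site d -> nat -> bool) (zeta : config d) (e : R -> config d) :=
  e 0 = zeta /\
  (forall x n s, clock tau x n <= s -> s < clock tau x n.+1 -> e s x = e (clock tau x n) x) /\
  (forall x n, e (clock tau x n.+1) x =
     if `[< exists i : 'I_d, left_value e (site_sub_e x i) (clock tau x n.+1) false >]
     then B x n else e (clock tau x n) x).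

(* Main.v *)
(** A legal ring resamples the spin with a fresh coin, and coins only influence sites
    above their own.  Hence, on the event that every site of a finite set [L] has been
    legally updated, each pattern on [L] has probability at most its equilibrium one
    (condition on the sites of [L] from the top down), so the distance to equilibrium on
    [L] is at most twice the sum over [x] in [L] of the probability that [x] was not
    updated.  This persistence probability decays exponentially, uniformly in the initial
    configuration, once there is a zero strictly below [x]: a zero at [z] stays until [z]
    is legally resampled, at which time some neighbour below [z] is zero while [z] carries
    a fresh coin, so that at any fixed time the distance from [z] to the nearest zero
    below it has a geometric tail.  Restarting from that zero, a site at distance [K]
    above [z] is updated within a constant time with probability close to 1; when [K] is
    large the nearest zero therefore drifts upwards in mean, and the exponential of its
    distance to [x] contracts by a constant factor per block of time.

    All of this is done for a discrete chain on a finite box, where time is cut into rows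
    of length [h] and each site rings in each row with probability [1 - expR (- h)].
    Rounding the clock increments up to multiples of [h] makes the rings of the actual
    process exactly such Bernoulli rows; as [h] tends to 0 the order of the rings is
    unchanged with probability tending to 1, and the influence of the spins outside the
    box vanishes as the box grows. *)
Require Import Defs.
From HB Require Import structures.
From mathcomp Require Import all_boot all_order all_algebra.
From mathcomp Require Import all_classical all_reals all_analysis.
From mathcomp Require Import measurable_realfun.
From mathcomp Require Import zify ring lra.
Set Implicit Arguments. Unset Strict Implicit. Unset Printing Implicit Defensive.
Import Order.TTheory GRing.Theory Num.Theory.
Import numFieldNormedType.Exports.
Local Open Scope classical_set_scope.
Local Open Scope ring_scope.

(** * The killed heat-bath operators *)

(** The trajectory is specified only by what it does at each ring, site by site, so neither a
    semigroup nor a Markov property in infinite volume is at hand. With a finite word of rings in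
    place of time, means are compositions of the operators [ring_op], and the orientation of the
    model and the strong Markov property become inductions on the word. Killing the chain at the
    legal rings of [x] turns the persistence probability of [x] into such a composition applied to
    the constant 1. The contraction must not see the discretisation: in [survival_decay] the block
    length and the base [b] depend only on [p] and on the probability [rho] that a site is silent
    for a unit of time, so the box and [h] may be chosen after $t$ and sent to their limits with $t$
    fixed. The base has to satisfy $1<b<1/p$: the distance to the nearest zero has a tail of ratio
    [p], and its exponential moment must be finite. The initial law enters only through a zero in
    $\{-m,\dots,0\}^d$ with $m=\lfloor\chi t\rfloor$; [chi] is so small that the factor
    $b^{d(m+n)}$, where the support has side $n$, loses against the halving per block. *)

Section SiteOrder.
Variable d : nat.
Implicit Types x y z : site d.

Definition lesite x y := [forall i, x i <= y i].
Definition ltsite x y := (x != y) && lesite x y.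
Definition dist x y : nat := (\sum_i `|(y i - x i)%R|)%N.
Definition site_add_e x (i : 'I_d) : site d := [ffun j => x j + ((j == i) : nat)%:Z].

Lemma lesiteP x y : reflect (forall i, x i <= y i) (lesite x y).
Proof. exact: forallP. Qed.

Lemma lesite_refl x : lesite x x.
Proof. by apply/lesiteP. Qed.

Lemma lesite_trans y x z : lesite x y -> lesite y z -> lesite x z.
Proof. by move=> /lesiteP h1 /lesiteP h2; apply/lesiteP => i; exact: le_trans (h2 i). Qed.

Lemma lesite_anti x y : lesite x y -> lesite y x -> x = y.
Proof.
move=> /lesiteP h1 /lesiteP h2; apply/ffunP => i.
by apply/eqP; rewrite eq_le h1 h2.
Qed.

Lemma lesite_lt_trans y x z : lesite x y -> ltsite y z -> ltsite x z.
Proof.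
move=> xy /andP[yz lyz]; rewrite /ltsite (lesite_trans xy lyz) andbT.
by apply: contra yz => /eqP xz; rewrite (@lesite_anti y z) // -xz.
Qed.

Lemma ltsite_le_trans y x z : ltsite x y -> lesite y z -> ltsite x z.
Proof.
move=> /andP[xy lxy] lyz; rewrite /ltsite (lesite_trans lxy lyz) andbT.
by apply: contra xy => /eqP xz; rewrite (@lesite_anti x y) // xz.
Qed.

Lemma site_sub_e_lt x i : ltsite (site_sub_e x i) x.
Proof.
apply/andP; split.
  by apply/eqP => /ffunP /(_ i); rewrite ffunE eqxx /=; lia.
by apply/lesiteP => j; rewrite ffunE; case: eqP => _ /=; lia.
Qed.

Lemma site_sub_e_le x i : lesite (site_sub_e x i) x.
Proof. by case/andP: (site_sub_e_lt x i). Qed.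

Lemma site_add_eK x i : site_sub_e (site_add_e x i) i = x.
Proof. by apply/ffunP => j; rewrite !ffunE addrK. Qed.

Lemma dist_trans x y z : lesite x y -> lesite y z ->
  dist x z = (dist x y + dist y z)%N.
Proof.
move=> /lesiteP h1 /lesiteP h2; rewrite /dist -big_split /=; apply: eq_bigr => i _.
by have := h1 i; have := h2 i; lia.
Qed.

Lemma dist_sub_e x i : dist (site_sub_e x i) x = 1%N.
Proof.
rewrite /dist (bigD1 i) //= big1 ?addn0 => [|j /negPf ji]; rewrite ffunE.
  by rewrite eqxx /=; lia.
by rewrite ji /=; lia.
Qed.

Lemma distxx x : dist x x = 0%N.
Proof. by rewrite /dist big1 // => i _; rewrite subrr. Qed.

Lemma dist_gt0 x y : ltsite x y -> (0 < dist x y)%N.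
Proof.
move=> /andP[xy lxy]; rewrite lt0n; apply: contra xy; rewrite sum_nat_eq0 => /forallP h.
by apply/eqP/ffunP => i; have := h i; rewrite implyTb absz_eq0 subr_eq0 => /eqP ->.
Qed.

Lemma ltsite_step x y : ltsite x y -> exists i, lesite (site_add_e x i) y.
Proof.
move=> /andP[xy /lesiteP lxy].
have [i xyi] : exists i, x i < y i.
  apply/existsP; apply: contraNT xy; rewrite negb_exists => /forallP h.
  by apply/eqP/ffunP => i; have := h i; rewrite -leNgt => yx; apply/eqP; rewrite eq_le yx lxy.
exists i; apply/lesiteP => j; rewrite ffunE.
by have := lxy j; case: eqP => [->|_] /=; lia.
Qed.

End SiteOrder.

(** * Operators of single rings and of words, and the upward propagation of influence *)

Section RingOperators.
Variables (R : realType) (d : nat) (p q : R) (V : seq (site d)).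
Hypotheses (p01 : 0 < p < 1) (q01 : 0 <= q <= 1).
Local Notation cfg := (site d -> bool).
Implicit Types (x y z : site d) (eta : cfg) (f g h : cfg -> R) (k : pred (site d)).
Implicit Types (L : seq (site d)) (M : R).

Let p0 : 0 <= p. Proof. by case/andP: p01 => /ltW. Qed.
Let p1 : 0 <= 1 - p. Proof. by rewrite subr_ge0; case/andP: p01 => _ /ltW. Qed.
Let q0 : 0 <= q. Proof. by case/andP: q01. Qed.
Let q1 : 0 <= 1 - q. Proof. by rewrite subr_ge0; case/andP: q01. Qed.

Definition flip eta x (b : bool) : cfg := fun y => if y == x then b else eta y.

(** Spins outside [V] count as ones, which makes the finite chain autonomous. The discrepancy with
    the infinite process is accounted for later by [tainted]. *)
Definition legal eta x :=
  [exists i, (site_sub_e x i \in V) && ~~ eta (site_sub_e x i)].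

Definition avg x f : cfg -> R :=
  fun eta => p * f (flip eta x true) + (1 - p) * f (flip eta x false).

(* The clock of [x] rings with probability [q]; a legal ring resamples the spin
   at [x], or kills the process if [k x]. *)
Definition ring_op k x f : cfg -> R := fun eta =>
  (1 - q) * f eta +
  q * (if legal eta x then (if k x then 0 else avg x f eta) else f eta).

(** These are backward operators, so the head of [L] rings first: the value at [eta] is the mean of
    [f] at the end of the word, started from [eta], on the event that the chain has not been
    killed. *)
Definition word_op k L f : cfg -> R := foldr (ring_op k) f L.

Lemma flip_flip eta x b c : flip (flip eta x b) x c = flip eta x c.
Proof. by apply/funext => y; rewrite /flip; case: eqP. Qed.

Lemma flipC eta x y b c : x != y ->
  flip (flip eta x b) y c = flip (flip eta y c) x b.
Proof.
move=> xy; apply/funext => z; rewrite /flip.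
by case: (eqVneq z y) => [->|//]; rewrite eq_sym (negPf xy).
Qed.

Lemma avg_le x f g : (forall eta, f eta <= g eta) -> forall eta, avg x f eta <= avg x g eta.
Proof. by move=> fg eta; rewrite lerD // ler_wpM2l. Qed.

Lemma ring_op_le_at k x f g eta :
  f eta <= g eta -> avg x f eta <= avg x g eta -> ring_op k x f eta <= ring_op k x g eta.
Proof.
move=> fg afg; rewrite lerD ?ler_wpM2l //.
by case: ifP => // _; case: ifP.
Qed.

Lemma word_op_le k L f g : (forall eta, f eta <= g eta) ->
  forall eta, word_op k L f eta <= word_op k L g eta.
Proof.
move=> fg; elim: L => [//|x L IH] eta /=.
by apply: ring_op_le_at => //; exact: avg_le.
Qed.

Lemma word_op_lin k L a b f g eta :
  word_op k L (fun eta => a * f eta + b * g eta) eta =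
  a * word_op k L f eta + b * word_op k L g eta.
Proof.
elim: L eta => [//|x L IH] eta /=; rewrite /ring_op /avg !IH.
by case: ifP => _; [case: ifP => _|]; ring.
Qed.

Lemma word_opD k L f g eta :
  word_op k L (fun eta => f eta + g eta) eta = word_op k L f eta + word_op k L g eta.
Proof.
have := word_op_lin k L 1 1 f g eta; rewrite !mul1r => <-.
by congr word_op; apply/funext => eta'; rewrite !mul1r.
Qed.

Lemma word_opZ k L a f eta :
  word_op k L (fun eta => a * f eta) eta = a * word_op k L f eta.
Proof.
have := word_op_lin k L a 0 f f eta; rewrite mul0r addr0 => <-.
by congr word_op; apply/funext => eta'; rewrite mul0r addr0.
Qed.

Lemma word_op0 k L eta : word_op k L (fun=> 0) eta = 0.
Proof.
transitivity (word_op k L (fun e => 0 * (fun=> 0) e) eta).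
  by congr word_op; apply/funext => e; rewrite mul0r.
by rewrite word_opZ mul0r.
Qed.

Lemma word_op_sum k L (I : Type) (r : seq I) (F : I -> cfg -> R) eta :
  word_op k L (fun eta => \sum_(i <- r) F i eta) eta = \sum_(i <- r) word_op k L (F i) eta.
Proof.
elim: r => [|i r IH].
  by rewrite big_nil -[RHS](word_op0 k L eta); congr word_op; apply/funext => e; rewrite big_nil.
rewrite big_cons -IH -word_opD; congr word_op.
by apply/funext => e; rewrite big_cons.
Qed.

Lemma word_op_ge0 k L f : (forall eta, 0 <= f eta) -> forall eta, 0 <= word_op k L f eta.
Proof. by move=> f0 eta; rewrite -(word_op0 k L eta); exact: word_op_le. Qed.

Lemma word_op_cat k L1 L2 f : word_op k (L1 ++ L2) f = word_op k L1 (word_op k L2 f).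
Proof. by rewrite /word_op foldr_cat. Qed.

Lemma word_op_cst L c eta : word_op xpred0 L (fun=> c) eta = c.
Proof.
elim: L eta => [//|x L IH] eta /=; rewrite /ring_op /avg !IH.
by case: ifP => _; ring.
Qed.

Lemma word_op_kill k L f : (forall eta, 0 <= f eta) ->
  forall eta, word_op k L f eta <= word_op xpred0 L f eta.
Proof.
move=> f0; elim: L => [//|x L IH] eta /=.
rewrite lerD ?ler_wpM2l //; case: ifP => // _; case: ifP => _; last exact: avg_le.
by rewrite addr_ge0 ?mulr_ge0 //; exact: word_op_ge0.
Qed.

Lemma word_op1_le k L eta : word_op k L (fun=> 1) eta <= 1.
Proof. by rewrite -[leRHS](word_op_cst L 1 eta) word_op_kill. Qed.

Lemma legal_flip eta x y b : (forall i, site_sub_e x i != y) ->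
  legal (flip eta y b) x = legal eta x.
Proof. by move=> h; apply: eq_existsb => i; rewrite /flip (negPf (h i)). Qed.

Lemma legal_flip_id eta x b : legal (flip eta x b) x = legal eta x.
Proof.
by apply: legal_flip => i; case/andP: (site_sub_e_lt x i).
Qed.

Definition upclosed (S : pred (site d)) := forall x i, S (site_sub_e x i) -> S x.

Definition insensitive (S : pred (site d)) f :=
  forall y b eta, S y -> f (flip eta y b) = f eta.

(** When [x] lies outside an up-closed [S], so do the neighbours below it, and the legality of a
    ring at [x] cannot feel the spins in [S]. *)
Lemma ring_op_insensitive S x f :
  upclosed S -> insensitive S f -> insensitive S (ring_op xpred0 x f).
Proof.
move=> upS fS y b eta Sy; rewrite /ring_op fS // /avg.
case: (eqVneq x y) => [->|xy]; first by rewrite legal_flip_id !flip_flip.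
rewrite ![flip (flip eta y b) _ _]flipC 1?eq_sym // !(fS y) //.
case: (boolP (S x)) => Sx; first by rewrite !fS //; do 2![case: ifP => _]; ring.
rewrite legal_flip // => i; apply: contra Sx => /eqP xiy.
by apply: (upS _ i); rewrite xiy.
Qed.

Lemma word_op_insensitive S L f :
  upclosed S -> insensitive S f -> insensitive S (word_op xpred0 L f).
Proof. by move=> upS fS; elim: L => [//|x L IH] /=; exact: ring_op_insensitive. Qed.

Lemma word_op_insensitive_id L f : insensitive xpredT f ->
  word_op xpred0 L f = f.
Proof.
move=> fT; apply/funext => eta; elim: L eta => [//|x L IH] eta /=.
by rewrite /ring_op /avg !IH !fT //; case: ifP => _; ring.
Qed.

Lemma upclosed_lt x : upclosed (ltsite x).
Proof.
by move=> y i h; exact: ltsite_le_trans h (site_sub_e_le y i).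
Qed.

Lemma upclosed_le x : upclosed (lesite x).
Proof.
by move=> y i h; exact: lesite_trans h (site_sub_e_le y i).
Qed.

(* Sites above [x] never influence [f], so a centered spin at [x] is unseen by
   the sites [f] depends on until [x] itself is resampled. *)
Lemma avg_word_op0 x L f : insensitive (ltsite x) f ->
  (forall eta, avg x f eta = 0) -> forall eta, avg x (word_op xpred0 L f) eta = 0.
Proof.
move=> fS; elim: L => [//|y L IH] f0 eta.
have IHf := IH f0; have {}IH : insensitive (ltsite x) (word_op xpred0 L f).
  by apply: word_op_insensitive => //; exact: upclosed_lt.
move: IHf IH => /=; set g := word_op xpred0 L f => g0 gS.
case: (boolP (ltsite x y)) => [xy|nxy].
  have E e : ring_op xpred0 y g e = g e.
    by rewrite /ring_op /avg !gS //; case: ifP => _; ring.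
  by rewrite /avg !E; exact: g0.
have legE b : legal (flip eta x b) y = legal eta y.
  apply: legal_flip => i; apply: contra nxy => /eqP <-; exact: site_sub_e_lt.
rewrite /avg /ring_op !legE.
have := g0 eta; rewrite /avg => gE.
case: (eqVneq y x) => [->|yx].
  rewrite /avg !flip_flip.
  case: ifP => _; last by rewrite -[RHS]gE; ring.
  transitivity ((1 - q) * (p * g (flip eta x true) + (1 - p) * g (flip eta x false))
    + q * (p * g (flip eta x true) + (1 - p) * g (flip eta x false))); first ring.
  by rewrite gE; ring.
rewrite /avg ![flip (flip eta x _) y _]flipC 1?eq_sym //.
case: ifP => _; last by rewrite -[RHS]gE; ring.
transitivity ((1 - q) * avg x g eta +
  q * (p * avg x g (flip eta y true) + (1 - p) * avg x g (flip eta y false))).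
  by rewrite /avg; ring.
by rewrite !g0; ring.
Qed.

(** The first legal ring of [x] averages the spin there, after which [avg_word_op0] gives zero. Only
    the paths on which [x] is never legally updated contribute, each at most [M]. *)
Lemma word_op_centered x L f M : insensitive (ltsite x) f ->
  (forall eta, avg x f eta = 0) -> (forall eta, `|f eta| <= M) ->
  forall eta, `|word_op xpred0 L f eta| <= M * word_op (pred1 x) L (fun=> 1) eta.
Proof.
move=> fS f0 fM; elim: L => [|y L IH] eta; first by rewrite /= mulr1.
have M0 : 0 <= M by exact: le_trans (fM eta).
rewrite /=; set g := word_op xpred0 L f; set u := word_op _ L _.
have u0 e : 0 <= u e by apply: word_op_ge0.
have gu e : `|g e| <= M * u e := IH e.
rewrite /ring_op /= mulrDr.
apply: le_trans (ler_normD _ _) _; rewrite !normrM !(ger0_norm q0) !(ger0_norm q1).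
rewrite ![M * (_ * _)]mulrCA; apply: lerD; first exact: ler_wpM2l.
apply: ler_wpM2l => //.
case: ifP => _ //; case: eqP => [->|_].
  by rewrite avg_word_op0 // normr0 mulr0.
apply: le_trans (ler_normD _ _) _; rewrite !normrM !(ger0_norm p0) !(ger0_norm p1).
by rewrite /avg mulrDr ![M * (_ * _)]mulrCA; apply: lerD; exact: ler_wpM2l.
Qed.

Definition avgs (s : seq (site d)) f := foldl (fun f x => avg x f) f s.

Lemma avg_norm x f M : (forall eta, `|f eta| <= M) -> forall eta, `|avg x f eta| <= M.
Proof.
move=> fM eta; apply: le_trans (ler_normD _ _) _.
rewrite !normrM !(ger0_norm p0) !(ger0_norm p1).
rewrite [leRHS](_ : M = p * M + (1 - p) * M); last ring.
by apply: lerD; exact: ler_wpM2l.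
Qed.

(** Telescoping over the sites of [s], averaged one after the other. The list goes from the top
    down: no site after [x] lies above [x], so [f - avg x f], centred at [x] and bounded by twice
    [M], ignores everything strictly above [x] and [word_op_centered] applies. *)
Lemma word_op_avgs L s f M :
  pairwise (fun x y => ~~ ltsite x y) s -> (forall eta, `|f eta| <= M) ->
  insensitive [pred y | y \notin s] f -> forall eta,
  `|word_op xpred0 L f eta - avgs s f eta| <=
  2 * M * \sum_(x <- s) word_op (pred1 x) L (fun=> 1) eta.
Proof.
elim: s f => [|x s IH] f.
  move=> _ _ fS eta; rewrite word_op_insensitive_id; last by move=> y b e _; exact: fS.
  by rewrite subrr normr0 big_nil mulr0.
rewrite pairwise_cons => /andP[/allP xs ss] fM fS eta; rewrite big_cons mulrDr.
have aS : insensitive [pred y | y \notin s] (avg x f).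
  move=> y b e ys; case: (eqVneq y x) => [->|yx]; first by rewrite /avg !flip_flip.
  rewrite /avg ![flip (flip e y b) _ _]flipC // !(fS y) //= inE negb_or;
  by rewrite yx; exact: ys.
have {}IH := IH (avg x f) ss (avg_norm x fM) aS eta.
rewrite -(subrKA (word_op xpred0 L (avg x f) eta)).
apply: le_trans (ler_normD _ _) (lerD _ IH).
rewrite -[X in `|X|](_ : word_op xpred0 L (fun e => f e - avg x f e) eta = _); last first.
  have := word_op_lin xpred0 L 1 (-1) f (avg x f) eta; rewrite mul1r mulN1r => <-.
  by congr word_op; apply/funext => e; rewrite mul1r mulN1r.
apply: word_op_centered => [y b e xy|e|e].
- have ys : y \notin x :: s.
    rewrite /= inE negb_or; case/andP: (xy) => xy' _; rewrite eq_sym xy' /=.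
    by apply/negP => /xs; rewrite xy.
  have yx : x != y by case/andP: xy.
  by rewrite (fS y) // /avg ![flip (flip e y b) _ _]flipC 1?eq_sym // !(fS y).
- by rewrite /avg !flip_flip; ring.
- apply: le_trans (ler_normB _ _) _.
  by rewrite mulr_natl mulr2n lerD // avg_norm.
Qed.

Definition zero_below eta z (m : nat) :=
  has (fun z' => [&& ~~ eta z', lesite z' z & (dist z' z <= m)%N]) V.

Lemma zero_below_insensitive z m S : (forall y, lesite y z -> ~~ S y) ->
  insensitive S (fun eta => (~~ zero_below eta z m)%:R).
Proof.
move=> hS y b eta Sy; congr (~~ _)%:R; apply: eq_in_has => z' _ /=.
case: (boolP (lesite z' z)) => [z'z|]; last by rewrite !andbF.
rewrite /flip; case: eqP => // z'y; move: Sy; rewrite -z'y => Sy.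
by have := hS _ z'z; rewrite Sy.
Qed.

(* The zero at [z] stays until [z] is resampled; then some [z - e_i] is zero,
   while the spin at [z] is a fresh coin, independent of the sites below. *)
Lemma geometric_zero L z m eta : z \in V -> ~~ eta z ->
  word_op xpred0 L (fun e => (~~ zero_below e z m)%:R) eta <= p ^+ m.+1.
Proof.
elim: L z m eta => [|y L IH] z m eta zV etaz.
  rewrite /= (_ : zero_below eta z m) ?exprn_ge0 //.
  by apply/hasP; exists z => //; rewrite etaz lesite_refl distxx.
rewrite /=; set h := word_op _ L _.
have IHz e : ~~ e z -> h e <= p ^+ m.+1 by exact: IH.
suff leg : legal eta y -> avg y h eta <= p ^+ m.+1.
  rewrite /ring_op [leRHS](_ : _ = (1 - q) * p ^+ m.+1 + q * p ^+ m.+1); last ring.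
  apply: lerD; apply: ler_wpM2l => //; first exact: IHz.
  by case: ifP => [/leg//|_]; exact: IHz.
case: (eqVneq y z) => [->|yz legy]; last first.
  rewrite /avg [leRHS](_ : _ = p * p ^+ m.+1 + (1 - p) * p ^+ m.+1); last ring.
  apply: lerD; apply: ler_wpM2l => //; apply: IHz;
  by rewrite /flip eq_sym (negPf yz).
move=> /existsP[i /andP[zV' etaz']].
set z' := site_sub_e z i in zV' etaz'.
(* Having no zero within [m] of [z] forces a one at [z] and, since [z'] is one step below, no zero
   within [m - 1] of [z']. For [m = 0] only the spin at [z] matters. *)
pose g : cfg -> R := fun e => if m is m'.+1 then (~~ zero_below e z' m')%:R else 1.
have gS : insensitive (lesite z) g.
  rewrite /g; case: (m) => [|m'] //; apply: zero_below_insensitive => y' y'z'.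
  apply/negP => zy'; have := lesite_lt_trans y'z' (site_sub_e_lt z i).
  by move=> /andP[/eqP + h']; apply; exact: lesite_anti.
have gh e : (~~ zero_below e z m)%:R <= (e z)%:R * g e :> R.
  case: (boolP (zero_below e z m)) => /= nz.
    by rewrite mulr_ge0 // /g; case: (m).
  have ez : e z.
    apply: contraNT nz => ez; apply/hasP; exists z => //.
    by rewrite ez lesite_refl distxx.
  rewrite ez mul1r /g; case: (m) nz => [//|m'] nz.
  rewrite (_ : ~~ zero_below e z' m') //; apply: contra nz => /hasP[u uV /and3P[eu uz' du]].
  apply/hasP; exists u => //; rewrite eu (lesite_trans uz' (site_sub_e_le z i)) /=.
  by rewrite (dist_trans uz' (site_sub_e_le z i)) dist_sub_e addn1.
(* As [g] looks only strictly below [z], subtracting [p * g] centres the product at [z]. The fresh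
   coin at [z] thus contributes an exact factor [p], whatever happens along [L]. *)
have step : avg z (word_op xpred0 L (fun e => (e z)%:R * g e)) eta =
    p * word_op xpred0 L g eta.
  have WS := word_op_insensitive L (@upclosed_le z) gS.
  have := @avg_word_op0 z L (fun e => (e z)%:R * g e - p * g e).
  have lin e : word_op xpred0 L (fun e => (e z)%:R * g e - p * g e) e =
      word_op xpred0 L (fun e => (e z)%:R * g e) e - p * word_op xpred0 L g e.
    have := word_op_lin xpred0 L 1 (-p) (fun e => (e z)%:R * g e) g e.
    rewrite mul1r mulNr => <-; congr word_op; apply/funext => e'; ring.
  move=> /(_ _ _ eta) H; rewrite -[LHS](subrK (p * word_op xpred0 L g eta)) -[RHS]add0r.
  congr (_ + _).
  rewrite -[RHS]H; first last.
  - by move=> e; rewrite /avg /flip eqxx !gS ?lesite_refl //=; ring.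
  - move=> y' b e zy'; have lzy : lesite z y' by case/andP: zy'.
    rewrite !gS //; congr (_ - _); congr (_%:R * _).
    by rewrite /flip; case: eqP => // zy; move: zy'; rewrite /ltsite -zy eqxx.
  by rewrite /avg !lin !WS ?lesite_refl //; ring.
apply: le_trans (_ : avg z (word_op xpred0 L (fun e => (e z)%:R * g e)) eta <= _).
  by apply: avg_le; apply: word_op_le.
rewrite step exprS; apply: ler_wpM2l => //.
rewrite /g; case: (m) => [|m']; first by rewrite word_op_cst expr0.
exact: IH.
Qed.

End RingOperators.

Arguments word_op_le {R d p q V} p01 q01 k L {f g}.
Arguments word_op_ge0 {R d p q V} p01 q01 k L {f}.
Arguments word_op_kill {R d p q V} p01 q01 k L {f}.
Arguments word_op1_le {R d p q V} p01 q01 k L.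

(** * Persistence of sites above a zero *)

Lemma exists_expr_le (R : realType) (r e : R) : 0 <= r < 1 -> 0 < e ->
  exists n, r ^+ n <= e.
Proof.
move=> /andP[r0 r1] e0.
have rc : (fun n => r ^+ n) @ \oo --> (0 : R^o) by apply: cvg_expr; rewrite ger0_norm.
have [N _ H] := cvgr_le 0 rc _ e0.
by exists N; apply: H => /=.
Qed.

Lemma le_add_expr_lim (R : realType) (r x y : R) : 0 <= r < 1 ->
  (forall J, x <= y + r ^+ J) -> x <= y.
Proof.
move=> r01 xy; rewrite leNgt; apply/negP => yx.
have [|n rn] := exists_expr_le r01 (_ : 0 < (x - y) / 2); first lra.
by have := xy n; lra.
Qed.

Section Survival.
Variables (R : realType) (d : nat) (p q : R) (V : seq (site d)).
Hypotheses (p01 : 0 < p < 1) (q01 : 0 <= q <= 1).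
Local Notation cfg := (site d -> bool).
Local Notation word_op := (word_op p q V).
Local Notation ring_op := (ring_op p q V).
Local Notation legal := (legal V).
Local Notation avg := (avg p).
Local Notation zero_below := (zero_below V).
Implicit Types (x y z w : site d) (eta : cfg) (f g h : cfg -> R) (k : pred (site d)).
Implicit Types L U : seq (site d).

Let p0 : 0 <= p. Proof. by case/andP: p01 => /ltW. Qed.
Let p1 : 0 <= 1 - p. Proof. by rewrite subr_ge0; case/andP: p01 => _ /ltW. Qed.
Let q0 : 0 <= q. Proof. by case/andP: q01. Qed.
Let q1 : 0 <= 1 - q. Proof. by rewrite subr_ge0; case/andP: q01. Qed.

Lemma avg_le_cst x f c eta :
  f (flip eta x true) <= c -> f (flip eta x false) <= c -> avg x f eta <= c.
Proof.
move=> h1 h2; rewrite /avg [leRHS](_ : c = p * c + (1 - p) * c); last ring.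
by apply: lerD; exact: ler_wpM2l.
Qed.

Lemma avg_ge_cst x f c eta :
  c <= f (flip eta x true) -> c <= f (flip eta x false) -> c <= avg x f eta.
Proof.
move=> h1 h2; rewrite /avg [leLHS](_ : c = p * c + (1 - p) * c); last ring.
by apply: lerD; exact: ler_wpM2l.
Qed.

(* Strong Markov property at the first legal ring of [w], at which time some
   neighbour below [w] is zero. *)
Lemma word_op_first w L f c : 0 <= c ->
  (forall L eta, legal eta w -> word_op xpred0 L f eta <= c) ->
  forall eta, word_op xpred0 L f eta <= c + word_op (pred1 w) L f eta.
Proof.
move=> c0 fc; elim: L => [|y L IH] eta /=; first by rewrite lerDr.
have fcL := fc L; set g := word_op _ L f in IH fcL *.
set u := word_op _ L f in IH *.
rewrite /ring_op /=.
have -> : c + ((1 - q) * u eta + q * (if legal eta y then if y == w then 0 else avg y u eta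
    else u eta)) = (1 - q) * (c + u eta) +
    q * (if legal eta y then if y == w then c else c + avg y u eta else c + u eta).
  by case: ifP => _; [case: ifP => _|]; ring.
apply: lerD; apply: ler_wpM2l => //.
case: ifP => // leg; case: eqP => yw.
  by apply: avg_le_cst; apply: fcL; rewrite -yw legal_flip_id.
have -> : c + avg y u eta = avg y (fun e => c + u e) eta by rewrite /avg; ring.
exact: (avg_le p01).
Qed.

Let pow1 n : (1 - q) ^+ n <= 1.
Proof. by rewrite exprn_ile1 // lerBlDr lerDl. Qed.

(** As long as the neighbour stays silent its zero persists and every ring of [w] is legal. Its
    silence and the presence of a ring of [w] are independent, which gives the product. *)
Lemma word_op_kill_neighbour w i L eta :
  site_sub_e w i \in V -> ~~ eta (site_sub_e w i) ->
  word_op (pred1 w) L (fun=> 1) eta <=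
  1 - (1 - q) ^+ count_mem (site_sub_e w i) L * (1 - (1 - q) ^+ count_mem w L).
Proof.
set z := site_sub_e w i => zV; elim: L eta => [|y L IH] eta etaz.
  by rewrite /= expr0 subrr mulr0 subr0.
have zw : z != w by case/andP: (site_sub_e_lt w i).
rewrite /=; set u := word_op _ L _ in IH *.
have u1 e : u e <= 1 by exact: word_op1_le.
have a1 := pow1 (count_mem z L); have b1 := pow1 (count_mem w L).
have a0 : 0 <= (1 - q) ^+ count_mem z L by exact: exprn_ge0.
move: IH a0 a1 b1.
set a := (1 - q) ^+ count_mem z L; set b := (1 - q) ^+ count_mem w L => IH a0 a1 b1.
rewrite /ring_op /= !exprD -/a -/b; case: (eqVneq y w) => [yw|yw].
  have -> : legal eta y by apply/existsP; exists i; rewrite yw zV etaz.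
  rewrite yw eq_sym (negPf zw) expr1 expr0 !mul1r mulr0 addr0.
  apply: le_trans (ler_wpM2l q1 (IH _ etaz)) _.
  rewrite -subr_ge0 [leRHS](_ : _ = q * (1 - a)); last ring.
  by rewrite mulr_ge0 // subr_ge0.
rewrite expr0 !mul1r; case: (eqVneq y z) => [yz|yz].
  rewrite expr1; apply: le_trans (_ : (1 - q) * (1 - a * (1 - b)) + q * 1 <= _).
    apply: lerD; apply: ler_wpM2l => //; first exact: IH.
    by case: ifP => // _; exact: avg_le_cst.
  by rewrite le_eqVlt; apply/orP; left; apply/eqP; ring.
rewrite expr0 mul1r [leRHS](_ : _ = (1 - q) * (1 - a * (1 - b)) + q * (1 - a * (1 - b)));
  last ring.
apply: lerD; apply: ler_wpM2l => //; first exact: IH.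
case: ifP => _; last exact: IH.
by apply: avg_le_cst; apply: IH; rewrite /flip eq_sym (negPf yz).
Qed.

(** Again the neighbour is silent and [w] rings. The factor [1 - p] comes from [ap]: once resampled,
    the spin at [w] is a Bernoulli variable at the end of any word, because it cannot influence the
    legality of its own later rings. *)
Lemma word_op_zero_neighbour w i L eta :
  site_sub_e w i \in V -> ~~ eta (site_sub_e w i) ->
  (1 - q) ^+ count_mem (site_sub_e w i) L * (1 - p) * (1 - (1 - q) ^+ count_mem w L) <=
  word_op xpred0 L (fun e => (~~ e w)%:R) eta.
Proof.
set z := site_sub_e w i => zV; elim: L eta => [|y L IH] eta etaz.
  by rewrite /= expr0 subrr mulr0.
have zw : z != w by case/andP: (site_sub_e_lt w i).
have ap e : avg w (word_op xpred0 L (fun e => (~~ e w)%:R)) e = 1 - p.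
  have lin e' : word_op xpred0 L (fun e => (~~ e w)%:R - (1 - p)) e' =
      word_op xpred0 L (fun e => (~~ e w)%:R) e' - (1 - p).
    have := word_opD p q V xpred0 L (fun e => (~~ e w)%:R) (fun=> - (1 - p)) e'.
    by rewrite word_op_cst.
  have := @avg_word_op0 _ _ p q V w L (fun e => (~~ e w)%:R - (1 - p)).
  move=> /(_ _ _ e) H; rewrite -[LHS](subrK (1 - p)) -[RHS]add0r; congr (_ + _).
  rewrite -[RHS]H.
  - by rewrite {2}/avg !lin /avg; ring.
  - by move=> y' b e' /andP[wy _]; rewrite /flip (negPf wy).
  - by move=> e'; rewrite /avg /flip eqxx /=; ring.
rewrite /=; set u := word_op _ L _ in IH ap *.
have u0 e : 0 <= u e by rewrite /u; apply: word_op_ge0 => // e'; exact: ler0n.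
have a1 := pow1 (count_mem z L); have b1 := pow1 (count_mem w L).
have a0 : 0 <= (1 - q) ^+ count_mem z L by exact: exprn_ge0.
move: IH a0 a1 b1.
set a := (1 - q) ^+ count_mem z L; set b := (1 - q) ^+ count_mem w L => IH a0 a1 b1.
rewrite /ring_op /= !exprD -/a -/b; case: (eqVneq y w) => [yw|yw].
  have -> : legal eta y by apply/existsP; exists i; rewrite yw zV etaz.
  rewrite yw eq_sym (negPf zw) expr1 expr0 !mul1r ap.
  apply: le_trans (lerD (ler_wpM2l q1 (IH _ etaz)) (lexx _)).
  rewrite -subr_ge0 [leRHS](_ : _ = q * ((1 - p) * (1 - a))); last ring.
  by rewrite !mulr_ge0 // subr_ge0.
rewrite expr0 !mul1r; case: (eqVneq y z) => [yz|yz].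
  rewrite expr1 -[leLHS]addr0; apply: lerD.
    by rewrite -!mulrA; apply: ler_wpM2l => //; rewrite mulrA; exact: IH.
  by rewrite mulr_ge0 //; case: ifP => // _; exact: avg_ge_cst.
rewrite expr0 mul1r [leLHS](_ : _ = (1 - q) * (a * (1 - p) * (1 - b)) +
  q * (a * (1 - p) * (1 - b))); last ring.
apply: lerD; apply: ler_wpM2l => //; first exact: IH.
case: ifP => _; last exact: IH.
by apply: avg_ge_cst; apply: IH; rewrite /flip eq_sym (negPf yz).
Qed.

Definition repeat_word n L := flatten (nseq n L).

Lemma repeat_wordS n L : repeat_word n.+1 L = repeat_word n L ++ L.
Proof.
rewrite /repeat_word; elim: n => [|n IH] /=; first by rewrite cats0.
by rewrite -catA -IH.
Qed.

Lemma repeat_wordM m n L : repeat_word m (repeat_word n L) = repeat_word (m * n) L.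
Proof.
elim: m => [//|m IH]; rewrite mulSn {1}/repeat_word /= -/(repeat_word _ _) IH.
by rewrite /repeat_word nseqD flatten_cat.
Qed.

Hypothesis convexV : forall z w x, z \in V -> w \in V -> lesite z x -> lesite x w -> x \in V.
Variables (rho : R) (U : seq (site d)).
Hypotheses (rho01 : 0 < rho < 1)
  (countU : forall z, z \in V -> (1 - q) ^+ count_mem z U = rho).

(** The word [U] plays the role of a unit of time, [rho] being the probability that a given site is
    silent along it. Then [c] bounds from below the probability that a zero hops one step up: the
    site of the zero is silent, the next one rings, and its coin is zero. *)
Let c := rho * (1 - p) * (1 - rho).

Lemma hop_prob01 : 0 < c <= 1.
Proof.
case/andP: rho01 => r0 r1; case/andP: p01 => pp0 pp1; apply/andP; split.
  by rewrite !mulr_gt0 // subr_gt0.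
by rewrite /c !mulr_ile1 ?mulr_ge0 // ?subr_ge0 ?(ltW r1) ?(ltW r0) //; lra.
Qed.

(** The zero climbs an oriented path from [z] to [w], one site per copy of [U]; convexity keeps the
    path in [V]. The last hop only has to update [w], which is likelier than [c]. *)
Lemma word_op_survive H z w eta : z \in V -> w \in V -> ltsite z w ->
  (dist z w <= H)%N -> ~~ eta z ->
  word_op (pred1 w) (repeat_word H U) (fun=> 1) eta <= 1 - c ^+ H.
Proof.
have /andP[c0 c1] := hop_prob01; case/andP: rho01 => r0 r1; case/andP: p01 => pp0 pp1.
elim: H z eta => [|H IH] z eta zV wV zw zwH etaz.
  by have := dist_gt0 zw; rewrite ltnNge zwH.
rewrite /repeat_word /= -/(repeat_word H U) word_op_cat.
have cH : 0 < c ^+ H <= 1 by rewrite exprn_gt0 // exprn_ile1 // ltW.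
case/andP: cH => cH0 cH1.
have [i] := ltsite_step zw; set x := site_add_e z i => xw.
have zx : z = site_sub_e x i by rewrite site_add_eK.
have zx' : lesite z x by rewrite zx site_sub_e_le.
have xV : x \in V by exact: convexV zx' xw.
rewrite zx in zV etaz zwH.
have u1 e : word_op (pred1 w) (repeat_word H U) (fun=> 1) e <= 1 by exact: word_op1_le.
have u0 e : 0 <= word_op (pred1 w) (repeat_word H U) (fun=> 1) e.
  exact: (word_op_ge0 p01 q01).
case: (eqVneq x w) => [xw'|xw'].
  apply: le_trans (word_op_le p01 q01 _ _ u1 _) _.
  rewrite -xw'; apply: le_trans (word_op_kill_neighbour _ zV etaz) _.
  rewrite !countU // lerD2l lerN2 exprS; apply: le_trans (ler_wpM2l (ltW c0) cH1) _.
  rewrite mulr1 /c ler_wpM2r ?subr_ge0 ?(ltW r1) //.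
  by rewrite ler_piMr ?(ltW r0) //; lra.
have xltw : ltsite x w by rewrite /ltsite xw'.
apply: le_trans (word_op_kill p01 q01 _ _ u0 _) _.
apply: le_trans (_ : word_op xpred0 U (fun e => 1 + - c ^+ H * (~~ e x)%:R) eta <= _).
  apply: (word_op_le p01 q01) => e; case: (boolP (e x)) => ex /=; first by rewrite mulr0 addr0.
  rewrite mulr1; apply: (IH x) => //; move: zwH.
  by rewrite (dist_trans (site_sub_e_le x i) xw) dist_sub_e.
rewrite word_opD word_op_cst word_opZ exprSr mulNr lerD2l lerN2.
apply: ler_wpM2l; first exact: ltW.
by apply: le_trans (word_op_zero_neighbour _ zV etaz); rewrite !countU.
Qed.

(** At the start of each block there is a zero within [G] below [z], hence within [K + G] below [w],
    except with probability [p ^+ G.+1]. The last block is peeled off; the recursion is a convex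
    combination, so the additive error does not accumulate with [j]. *)
Lemma word_op_update_prob K G j z w eta : z \in V -> w \in V -> ltsite z w ->
  (dist z w <= K)%N -> ~~ eta z ->
  word_op (pred1 w) (repeat_word j (repeat_word (K + G) U)) (fun=> 1) eta <=
  (1 - c ^+ (K + G)) ^+ j + p ^+ G.+1.
Proof.
move=> zV wV zw zwK etaz; have /andP[c0 c1] := hop_prob01.
have cH0 : 0 <= c ^+ (K + G) by rewrite exprn_ge0 // ltW.
have cH1 : c ^+ (K + G) <= 1 by rewrite exprn_ile1 // ltW.
move: cH0 cH1 (@word_op_survive (K + G)).
set c' := c ^+ _; set B := repeat_word (K + G) U => cH0 cH1 surv.
have P0 : 0 <= p ^+ G.+1 by exact: exprn_ge0.
elim: j => [|j IH]; first by rewrite /= lerDl.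
rewrite repeat_wordS word_op_cat.
apply: le_trans (_ : word_op (pred1 w) (repeat_word j B)
   (fun e => (1 - c') * 1 + c' * (~~ zero_below e z G)%:R) eta <= _).
  apply: (word_op_le p01 q01) => e; case: (boolP (zero_below e z G)) => [|_] /=; last first.
    rewrite !mulr1 subrK; exact: word_op1_le.
  move=> /hasP[z' z'V /and3P[ez' z'z dz'z]]; rewrite mulr1 mulr0 addr0.
  apply: (surv z') => //; first exact: lesite_lt_trans zw.
  have zw' : lesite z w by case/andP: zw.
  by rewrite (dist_trans z'z zw') addnC; exact: leq_add.
rewrite word_op_lin exprS.
apply: le_trans (lerD (ler_wpM2l _ IH) (ler_wpM2l cH0 (_ : _ <= p ^+ G.+1))) _.
- by rewrite subr_ge0.
- apply: le_trans (word_op_kill p01 q01 _ _ _ _) _; first by move=> e; exact: ler0n.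
  exact: geometric_zero.
- by rewrite le_eqVlt; apply/orP; left; apply/eqP; ring.
Qed.

Lemma geometric_sum_le (r : R) m n : 0 <= r < 1 ->
  \sum_(m <= i < n) r ^+ i.+1 <= r ^+ m.+1 / (1 - r).
Proof.
move=> /andP[r0 r1]; have r1' : 0 < 1 - r by rewrite subr_gt0.
have [nm|mn] := leqP n m; first by rewrite big_geq // divr_ge0 ?exprn_ge0 // ltW.
have E (k : nat) : (\sum_(m <= i < m + k) r ^+ i.+1) * (1 - r) = r ^+ m.+1 - r ^+ (m + k).+1.
  elim: k => [|k IH]; first by rewrite addn0 big_geq // mul0r subrr.
  by rewrite addnS big_nat_recr ?leq_addr //= mulrDl IH !exprS; ring.
rewrite ler_pdivlMr // -(subnKC (ltnW mn)) E.
by rewrite lerBlDr lerDl exprn_ge0.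
Qed.

(** With $D$ the distance from [z] to the nearest zero below, [h] is at most $B b^D$. The part $D\le
    k_0$ keeps the survival probability, and the rest is summed against the geometric tail of $D$.
    As $D$ may be infinite, the sum is cut at [k0 + J]; beyond it [h] is at most 1 and costs at most
    [p ^+ J], removed by letting [J] grow. *)
Lemma word_op_tail k L h z (B b : R) (k0 : nat) eta :
  z \in V -> ~~ eta z -> 0 <= B -> 0 <= b -> b * p < 1 ->
  (forall e, 0 <= h e <= 1) ->
  (forall m e, zero_below e z m -> h e <= B * b ^+ m) ->
  word_op k L h eta <=
    B * (b ^+ k0 * word_op k L (fun=> 1) eta + (b * p) ^+ k0.+1 / (1 - b * p)).
Proof.
move=> zV etaz B0 b0 bp1 h01 hB.
apply: (@le_add_expr_lim _ p); [by case/andP: p01 => /ltW -> ->|move=> J].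
pose N m (e : cfg) : R := (~~ zero_below e z m)%:R.
have N0 m e : 0 <= N m e by exact: ler0n.
have NE m : word_op k L (N m) eta <= p ^+ m.+1.
  by apply: le_trans (word_op_kill p01 q01 _ _ (N0 m) _) _; exact: geometric_zero.
have bound e : h e <= B * b ^+ k0 * 1 +
    ((\sum_(k0 <= m < k0 + J) B * b ^+ m.+1 * N m e) + N (k0 + J)%N e).
  have s0 n : 0 <= \sum_(k0 <= m < n) B * b ^+ m.+1 * N m e.
    by apply: sumr_ge0 => m _; rewrite !mulr_ge0 // exprn_ge0.
  have Bb0 m : 0 <= B * b ^+ m by rewrite mulr_ge0 // exprn_ge0.
  case/andP: (h01 e) => h0 h1; rewrite mulr1.
  elim: J => [|J IH].
    rewrite addn0 big_geq // add0r /N; case: (boolP (zero_below e z k0)) => [|_] /=.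
      by rewrite addr0; exact: hB.
    by rewrite ler_wpDl.
  rewrite addnS; case: (boolP (zero_below e z (k0 + J).+1)) => [zb|nzb]; last first.
    by rewrite {2}/N nzb /= addrA ler_wpDl // addr_ge0.
  rewrite big_nat_recr ?leq_addr //= {3}/N zb /= addr0.
  move: IH; rewrite /N; case: (boolP (zero_below e z (k0 + J))) => _ /=.
    by rewrite mulr0 !addr0.
  by move=> _; rewrite mulr1; apply: ler_wpDl => //; apply: ler_wpDl => //; exact: hB.
apply: le_trans (word_op_le p01 q01 k L bound eta) _.
rewrite word_opD word_opZ word_opD word_op_sum.
rewrite mulrDr -!addrA mulrA lerD2l; apply: lerD; last first.
  apply: le_trans (NE _) _; rewrite ler_wiXn2l //; first by case/andP: p01 => _ /ltW.
  by rewrite -addSn leq_addl.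
apply: le_trans (_ : \sum_(k0 <= m < k0 + J) B * (b * p) ^+ m.+1 <= _).
  apply: ler_sum => m _; rewrite word_opZ exprMn mulrA ler_wpM2l //.
  by rewrite mulr_ge0 // exprn_ge0.
by rewrite -mulr_sumr ler_wpM2l // geometric_sum_le // mulr_ge0.
Qed.

End Survival.

Lemma intermediate_site d (z x : site d) K : lesite z x -> (K <= dist z x)%N ->
  exists w, [/\ lesite z w, lesite w x & dist z w = K].
Proof.
elim: K => [|K IH] zx Kd; first by exists z; rewrite lesite_refl distxx.
have [w [zw wx dw]] := IH zx (ltnW Kd).
have wx' : ltsite w x.
  rewrite /ltsite wx andbT; apply: contraTneq Kd => <-; by rewrite dw ltnn.
have [i wi] := ltsite_step wx'; exists (site_add_e w i).
have le : lesite w (site_add_e w i) by rewrite -{1}(site_add_eK w i) site_sub_e_le.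
split => //; first exact: lesite_trans le.
by rewrite (dist_trans zw le) dw -{1}(site_add_eK w i) dist_sub_e addn1.
Qed.

(** The function $b^{\mathrm{dist}}$ to the current zero is a Lyapunov function, halved by each
    block. The constants come before the dimension, the box, [q] and [U], which makes the later
    limits possible. *)
Lemma survival_decay (R : realType) (p rho : R) : 0 < p < 1 -> 0 < rho < 1 ->
  exists (T : nat) (b : R), [/\ (0 < T)%N, 1 < b &
  forall (d : nat) (q : R) (V U : seq (site d)), 0 <= q <= 1 ->
    (forall z w x : site d, z \in V -> w \in V -> lesite z x -> lesite x w -> x \in V) ->
    (forall z : site d, z \in V -> (1 - q) ^+ count_mem z U = rho) ->
    forall n (x z : site d) (eta : site d -> bool), x \in V -> z \in V -> ltsite z x -> ~~ eta z ->
    word_op p q V (pred1 x) (repeat_word n (repeat_word T U)) (fun=> 1) eta <=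
      2^-1 ^+ n * b ^+ dist z x].
Proof.
move=> p01 rho01; case/andP: (p01) => p0 p1.
(* The midpoint of 1 and [p^-1], so that [b > 1] while [b * p < 1]. *)
pose b := (p^-1 + 1) / 2.
have b1 : 1 < b by rewrite ltr_pdivlMr // mul1r; have := invf_gt1 p0; rewrite p1 => h; lra.
have b0 : 0 <= b by lra.
have bpE : b * p = (1 + p) / 2 by rewrite /b; field; rewrite gt_eqF.
have bp1 : b * p < 1 by rewrite bpE; lra.
have bp0 : 0 <= b * p by rewrite bpE; lra.
have bb : 0 < 1 - b * p by rewrite subr_gt0.
clearbody b.
have bV : 0 <= b^-1 < 1 by rewrite invr_ge0 b0 invf_lt1 //; lra.
have bK n : b ^+ n * b^-1 ^+ n = 1 by rewrite -exprMn divff ?expr1n // gt_eqF //; lra.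
have bn0 n : 0 <= b ^+ n by exact: exprn_ge0.
have e0 : 0 < (1 - b * p) / 8 by rewrite divr_gt0.
(* A gain of [K0] sites must pay for the exponential moment $1/(1-bp)$ and leave $1/8$. Then [k0]
   bounds the tail term by $1/8$, while [G] and [j] bound the failure to update, weighted by
   [b ^+ k0], by $1/4$. The extra site in [K] is lost because the new zero sits just below the
   updated site. *)
have [K0 K0P] := exists_expr_le bV e0; pose K := K0.+1.
have [k0 k0P] : exists n, (b * p) ^+ n <= (1 - b * p) / 8.
  by apply: exists_expr_le => //; rewrite bp0.
have th0 : 0 < b^-1 ^+ k0 / 8 by rewrite divr_gt0 // exprn_gt0 // invr_gt0; lra.
have [G GP] : exists n, p ^+ n <= b^-1 ^+ k0 / 8.
  by apply: exists_expr_le => //; rewrite ltW.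
pose c := (rho * (1 - p) * (1 - rho)) ^+ (K + G).
have c01 : 0 <= 1 - c < 1.
  have /andP[h0 h1] := hop_prob01 p01 rho01.
  apply/andP; split; first by rewrite subr_ge0 exprn_ile1 // ltW.
  by rewrite gtrBl exprn_gt0.
have [j jP] := exists_expr_le c01 th0.
exists (j.+1 * (K + G))%N, b; split => // d q V U q01 convexV countU.
have upd z w (eta : site d -> bool) : z \in V -> w \in V -> ltsite z w ->
    (dist z w <= K)%N -> ~~ eta z ->
    b ^+ k0 * word_op p q V (pred1 w) (repeat_word (j.+1 * (K + G)) U) (fun=> 1) eta <= 4^-1.
  move=> zV wV zw zwK etaz; rewrite -repeat_wordM.
  apply: le_trans (ler_wpM2l (bn0 k0)
    (word_op_update_prob p01 q01 convexV rho01 countU G j.+1 zV wV zw zwK etaz)) _.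
  rewrite -/c; apply: le_trans (_ : b ^+ k0 * (b^-1 ^+ k0 / 8 + b^-1 ^+ k0 / 8) <= _).
    apply: ler_wpM2l => //; apply: lerD; rewrite exprS.
      by apply: le_trans jP; apply: ler_piMl; [rewrite exprn_ge0|]; lra.
    by apply: le_trans GP; apply: ler_piMl; [rewrite exprn_ge0|]; lra.
  rewrite [leLHS](_ : _ = (b ^+ k0 * b^-1 ^+ k0) / 4); last by field.
  by rewrite bK; lra.
have tail0 : (b * p) ^+ k0.+1 / (1 - b * p) <= 8^-1.
  rewrite ler_pdivrMr // exprS mulrC.
  apply: le_trans (ler_wpM2r bp0 k0P) _.
  by rewrite mulrC (mulrC _ (1 - b * p)); apply: ler_piMl; [rewrite divr_ge0|]; lra.
move=> n x z eta xV; elim: n z eta => [|n IH] z eta zV zx etaz.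
  by rewrite /= expr0 mul1r exprn_ege1 // ltW.
have -> : repeat_word n.+1 (repeat_word (j.+1 * (K + G)) U) =
   repeat_word (j.+1 * (K + G)) U ++ repeat_word n (repeat_word (j.+1 * (K + G)) U) by [].
rewrite word_op_cat; set L := repeat_word (j.+1 * (K + G)) U in upd IH *.
set h := word_op p q V (pred1 x) (repeat_word n L) (fun=> 1).
have h01 e : 0 <= h e <= 1 by rewrite (word_op_ge0 p01 q01) // (word_op1_le p01 q01).
have lam0 : 0 <= (2^-1 : R) ^+ n by rewrite exprn_ge0 // invr_ge0.
have hB z' : z' \in V -> ltsite z' x -> forall m e, zero_below V e z' m ->
    h e <= 2^-1 ^+ n * b ^+ dist z' x * b ^+ m.
  move=> z'V z'x m e /hasP[y yV /and3P[ey yz' dy]].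
  apply: le_trans (IH y e yV (lesite_lt_trans yz' z'x) ey) _.
  have z'x' : lesite z' x by case/andP: z'x.
  rewrite -mulrA; apply: ler_wpM2l => //; rewrite -exprD; apply: ler_weXn2l; first exact: ltW.
  by rewrite (dist_trans yz' z'x') addnC leq_add2l.
set B := 2^-1 ^+ n * b ^+ dist z x.
have B0 : 0 <= B by rewrite mulr_ge0.
have main w : w \in V -> ltsite z w -> (dist z w <= K)%N ->
    word_op p q V (pred1 w) L h eta <= B * (4^-1 + 8^-1).
  move=> wV zw zwK.
  apply: le_trans (word_op_tail p01 q01 _ _ k0 zV etaz B0 b0 bp1 h01 (hB z zV zx)) _.
  apply: ler_wpM2l; first exact: B0.
  apply: lerD; last exact: tail0.
  exact: (upd z w eta zV wV zw zwK etaz).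
have -> : 2^-1 ^+ n.+1 * b ^+ dist z x = B / 2 by rewrite /B exprS; ring.
have [zxK|Kzx] := leqP (dist z x) K.
  by apply: le_trans (main x xV zx zxK) _; apply: ler_wpM2l => //; lra.
have [w [zw wx dzw]] := intermediate_site (proj2 (andP zx)) (ltnW Kzx).
have wV : w \in V by exact: convexV zw wx.
have zw' : ltsite z w.
  by rewrite /ltsite zw andbT; apply/eqP => zwE; move: dzw; rewrite zwE distxx.
have h0 e : 0 <= h e by case/andP: (h01 e).
(* When [x] is farther than [K], stop at the first legal ring of [w], at distance [K] above [z].
   Restarting there costs [B / 8], and no such ring in the block costs $3B/8$, which sum to
   [B / 2]. *)
apply: le_trans (word_op_kill p01 q01 _ _ h0 _) _.
have C0 : 0 <= B / 8 by rewrite divr_ge0.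
apply: le_trans (@word_op_first _ _ p q V p01 q01 w L h (B / 8) C0 _ eta) _; last first.
  apply: le_trans (lerD (lexx _) (main w wV zw' _)) _; first by rewrite dzw.
  by rewrite -mulrDr; apply: ler_wpM2l => //; lra.
move=> L' e /existsP[i /andP[yV ey]].
(* The new zero [y] is closer to [x] than [z] by [K0] sites. The tail bound with cutoff 0 covers the
   remaining letters of the block, however many there are. *)
set y := site_sub_e w i in yV ey.
have yx : ltsite y x := ltsite_le_trans (site_sub_e_lt w i) wx.
have By0 : 0 <= 2^-1 ^+ n * b ^+ dist y x by rewrite mulr_ge0.
apply: le_trans (word_op_tail p01 q01 _ _ 0 yV ey By0 b0 bp1 h01 (hB y yV yx)) _.
rewrite word_op_cst expr0 mul1r expr1 (dist_trans (site_sub_e_le w i) wx) dist_sub_e.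
have -> : 1 + b * p / (1 - b * p) = (1 - b * p)^-1 by field; rewrite gt_eqF.
rewrite /B (dist_trans zw wx) dzw /K.
rewrite [leLHS](_ : _ = 2^-1 ^+ n * b ^+ (1 + dist w x) / (1 - b * p)); last by [].
rewrite ler_pdivrMr // !exprD expr1 -!mulrA; apply: ler_wpM2l => //.
rewrite exprS -!mulrA; apply: ler_wpM2l => //.
apply: le_trans (_ : b ^+ dist w x * (b ^+ K0 * b^-1 ^+ K0) <= _).
  by rewrite bK mulr1.
rewrite mulrCA; apply: ler_wpM2l => //; apply: ler_wpM2l => //.
by apply: le_trans K0P _; rewrite mulrC.
Qed.

(** * Law of the discretised rings *)

Section IndependentSymbols.
Variables (R : realType) (S : finType) (wt : S -> R).

Fixpoint iid_mean n (F : seq S -> R) : R :=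
  if n is n'.+1 then \sum_s wt s * iid_mean n' (fun a => F (s :: a)) else F [::].

Variables (dT : measure_display) (T : measurableType dT) (P : probability T R).
Variables (n : nat) (W : T -> seq S).
Hypothesis sizeW : forall w, size (W w) = n.
Hypothesis mW : forall a : seq S, (size a <= n)%N ->
  measurable [set w | take (size a) (W w) = a].
Hypothesis PW : forall a : seq S, (size a <= n)%N ->
  P [set w | take (size a) (W w) = a] = (\prod_(s <- a) wt s)%:E.

Let C (a : seq S) := [set w | take (size a) (W w) = a].

Lemma integral_bigsetU_fin (r : seq S) (D : S -> set T) (f : T -> R) :
  uniq r -> (forall s, measurable (D s)) -> (forall s, measurable_fun (D s) f) ->
  (forall s s', s != s' -> [disjoint D s & D s']) ->
  measurable_fun (\big[setU/set0]_(s <- r) D s) f /\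
  (\int[P]_(w in \big[setU/set0]_(s <- r) D s) (f w)%:E =
   \sum_(s <- r) \int[P]_(w in D s) (f w)%:E)%E.
Proof.
move=> + mD mf disj; elim: r => [|s r IH].
  move=> _; rewrite !big_nil; split; last by rewrite integral_set0.
  exact: measurable_fun_set0.
move=> /andP[sr ur]; have [mr Ir] := IH ur; rewrite !big_cons.
have mU : measurable (\big[setU/set0]_(s <- r) D s) by exact: bigsetU_measurable.
have mfU : measurable_fun (D s `|` \big[setU/set0]_(s <- r) D s) f.
  by apply/measurable_funU.
split => //; rewrite integral_setU // ?Ir //; first exact/measurable_EFinP.
rewrite disj_set2E; apply/eqP; rewrite -bigcup_seq setI_bigcupr bigcup0 // => s' /= s'r.
by apply/eqP; rewrite -disj_set2E disj //; apply: contraTneq s'r => <-.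
Qed.

(** Induction on the number [m] of letters still unread: a cylinder is the disjoint union of its
    refinements by the next letter. *)
Lemma integral_cylinder m a F : (size a + m)%N = n ->
  measurable_fun (C a) (fun w => F (W w)) /\
  (\int[P]_(w in C a) (F (W w))%:E =
   (\prod_(s <- a) wt s * iid_mean m (fun b => F (a ++ b)))%:E)%E.
Proof.
elim: m a F => [|m IH] a F am.
  have WE w : w \in C a -> F (W w) = F a.
    rewrite inE => <-; rewrite take_oversize // sizeW; lia.
  split.
    by apply: (eq_measurable_fun (cst (F a))) => [w /WE -> //|]; exact: measurable_cst.
  rewrite (eq_integral (cst (F a)%:E)); last by move=> w /WE /= ->.
  have an : (size a <= n)%N by lia.
  rewrite integral_cst; last exact: mW.
  by rewrite [X in (_ * X)%E]PW // -EFinM mulrC /= cats0.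
have split_a : C a = \big[setU/set0]_(s <- index_enum S) C (rcons a s).
  rewrite -bigcup_seq; apply/seteqP; split => w /=.
    move=> wa; have [s0] : exists s0 : S, True.
      have : (0 < size (W w))%N by rewrite sizeW; lia.
      by case: (W w) => // s0; exists s0.
    exists (nth s0 (W w) (size a)); first exact: mem_index_enum.
    rewrite /C /= size_rcons (take_nth s0) ?wa // sizeW; lia.
  move=> [s _]; rewrite /C /= size_rcons => /(congr1 (take (size a))).
  by rewrite take_takel // -cats1 take_size_cat.
have sz s : (size (rcons a s) + m)%N = n by rewrite size_rcons; lia.
have mC s : measurable (C (rcons a s)).
  by apply: mW; rewrite -(sz s) leq_addr.
have disj s s' : s != s' -> [disjoint C (rcons a s) & C (rcons a s')].
  move=> ss'; rewrite disj_set2E; apply/eqP; rewrite -subset0 => w [].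
  rewrite /C /= !size_rcons => -> /rcons_inj[] /eqP; exact/negP.
have [mf If] := integral_bigsetU_fin (index_enum_uniq S) mC
  (fun s => (IH (rcons a s) F (sz s)).1) disj.
rewrite split_a; split => //; rewrite If.
rewrite (eq_bigr (fun s => (\prod_(s <- a) wt s *
   (wt s * iid_mean m (fun b => F (a ++ s :: b))))%:E)).
  by rewrite sumEFin -mulr_sumr.
move=> s _; rewrite (IH (rcons a s) F (sz s)).2 -cats1 big_cat big_seq1 -mulrA.
congr (_ * (_ * iid_mean _ _))%:E.
by apply/funext => b; rewrite -catA.
Qed.

Lemma integral_iid F : measurable_fun setT (fun w => F (W w)) /\
  (\int[P]_w (F (W w))%:E = (iid_mean n F)%:E)%E.
Proof.
have [] := @integral_cylinder n [::] F erefl.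
have -> : C [::] = setT by apply/seteqP; split => w //= _; rewrite /C /= take0.
by rewrite big_nil mul1r.
Qed.

End IndependentSymbols.

(* A clock read in rows of length [h]: in state [(i, c)], [i] rings have
   occurred, the last of them [c] rows ago; ring [i] comes [g i] rows later. *)
Section RingAutomaton.
Variables (g : nat -> nat) (b : nat -> bool).
Local Open Scope nat_scope.

Definition ring_step (s : nat * nat) : nat * nat :=
  if g s.1 == s.2 then (s.1.+1, 0) else (s.1, s.2.+1).

Definition ring_state s k := iter k ring_step s.

Definition ring_symbol s k : option bool :=
  if g (ring_state s k).1 == (ring_state s k).2 then Some (b (ring_state s k).1) else None.

(** Rewrites a prescribed pattern of rows as one condition per increment and per coin, the form to
    which independence applies. At the end the pending increment is only known to exceed the [c]
    rows elapsed, hence the inequality. *)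
Fixpoint symbols_match i c (a : seq (option bool)) : bool :=
  match a with
  | [::] => c <= g i
  | None :: a' => symbols_match i c.+1 a'
  | Some s :: a' => [&& g i == c, b i == s & symbols_match i.+1 0 a']
  end.

Lemma symbols_match_ge i c a : symbols_match i c a -> c <= g i.
Proof.
elim: a c => [//|[s|] a IH] c /=; first by case/andP => /eqP ->.
by move=> /IH; exact: ltnW.
Qed.

Lemma ring_symbolS s k : ring_symbol s k.+1 = ring_symbol (ring_step s) k.
Proof. by rewrite /ring_symbol /ring_state iterSr. Qed.

Lemma symbols_matchP i c a : c <= g i ->
  (symbols_match i c a <-> forall k, k < size a -> ring_symbol (i, c) k = nth None a k).
Proof.
elim: a i c => [|s a IH] i c cg; first by rewrite /= cg.
have sym0 : ring_symbol (i, c) 0 = if g i == c then Some (b i) else None by [].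
have split_k : (forall k, k < size (s :: a) -> ring_symbol (i, c) k = nth None (s :: a) k) <->
    ring_symbol (i, c) 0 = s /\
    (forall k, k < size a -> ring_symbol (ring_step (i, c)) k = nth None a k).
  split=> [H|[H0 H] [|k] //= ka]; last by rewrite ring_symbolS H.
  by split=> [|k ka]; [exact: (H 0)|rewrite -ring_symbolS (H k.+1)].
rewrite split_k sym0 /ring_step /=; case: s {sym0 split_k} => [s|].
  case: eqP => gc; last by split=> // -[].
  by rewrite -IH //; split=> [/and3P[_ /eqP -> ->]|[[->] ->]]; rewrite ?eqxx.
case: eqP => gc.
  by split=> [/symbols_match_ge|[]//]; rewrite gc ltnn.
rewrite -IH; last by rewrite ltn_neqAle cg andbT eq_sym; apply/eqP.
by split=> // -[].
Qed.

End RingAutomaton.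

Section Gap.
Variables (R : realType) (h : R).
Hypothesis h0 : 0 < h.

(** The number of silent rows before the ring: an increment is rounded up to [(gap t).+1] rows.
    Nonpositive values, of probability zero, are also sent to 0. *)
Definition gap (t : R) : nat := if t <= h then 0%N else `|Num.ceil (t / h)|%N.-1.

Lemma gap_ge t c : (c <= gap t)%N = (c == 0%N) || (c%:R * h < t).
Proof.
rewrite /gap; case: (leP t h) => th.
  case: (posnP c) => [-> //|cgt0]. rewrite leqn0 gtn_eqF //=.
  apply/esym/negbTE; rewrite -leNgt; apply: le_trans th _.
  by apply: ler_peMl; [exact: ltW|rewrite ler1n].
have t0 : 0 < t by exact: lt_trans th.
have c1 : 1 < Num.ceil (t / h) by rewrite ceil_gt_int ltr_pdivlMr // mul1r.
have -> : (c <= `|Num.ceil (t / h)|%N.-1)%N = (c%:Z < Num.ceil (t / h)) by lia.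
rewrite ceil_gt_int ltr_pdivlMr // -pmulrn.
by case: eqP => // ->; rewrite mul0r t0.
Qed.

Lemma gap_lt t : 0 < t -> (gap t)%:R * h < t.
Proof.
move=> t0; have := gap_ge t (gap t); rewrite leqnn => /esym /orP[/eqP -> |//].
by rewrite mul0r.
Qed.

Lemma le_gap t : t <= (gap t).+1%:R * h.
Proof. by rewrite leNgt; have := gap_ge t (gap t).+1; rewrite ltnn /= => <-. Qed.

End Gap.

(** * Independence of the rows of all clocks *)

Section RingLaw.
Variables (R : realType) (d : nat) (p h : R) (dO : measure_display) (O : measurableType dO).
Variables (P : probability O R) (tau : site d -> nat -> O -> R) (B : site d -> nat -> O -> bool).
Hypotheses (p01 : 0 < p < 1) (h0 : 0 < h).
Let X (j : (site d * nat) + (site d * nat)) : O -> R := match j with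
  | inl (x, n) => fun w => ((B x n w : nat)%:R : R)
  | inr (x, n) => tau x n end.
Hypothesis indep : mutually_independent P X.
Hypothesis PB : forall x n, P [set w | B x n w] = p%:E.
Hypothesis Ptau : forall x n (s : R), P [set w | tau x n w <= s] =
  (if s < 0 then 0 else 1 - expR (- s))%:E.
Variable V : seq (site d).
Hypothesis uV : uniq V.

Let r : R := expR (- h).

Definition symbol_weight (s : option bool) : R :=
  match s with
  | None => r
  | Some c => (1 - r) * (if c then p else 1 - p)
  end.

Definition symbol x k w : option bool :=
  ring_symbol (fun i => gap h (tau x i w)) (fun i => B x i w) (0, 0)%N k.

Definition count_succ (cnt : site d -> nat) y x : nat := if x == y then (cnt x).+1 else cnt x.

(** Each site has its own row counter: a letter [y] reads the row whose number is the count of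
    earlier occurrences of [y]. Different positions thus read different pairs of site and row. *)
Fixpoint word_symbols cnt (L : seq (site d)) w : seq (option bool) :=
  if L is y :: L' then symbol y (cnt y) w :: word_symbols (count_succ cnt y) L' w else [::].

Lemma size_word_symbols cnt L w : size (word_symbols cnt L w) = size L.
Proof. by elim: L cnt => //= y L IH cnt; rewrite IH. Qed.

Lemma take_word_symbols cnt L w m :
  take m (word_symbols cnt L w) = word_symbols cnt (take m L) w.
Proof. by elim: L cnt m => [|y L IH] cnt [|m] //=; rewrite IH. Qed.

Let mX j : measurable_fun setT (X j). Proof. exact: indep.1. Qed.

Let ge_set c : set R := [set t | (c <= gap h t)%N].
Let eq_set c : set R := [set t | gap h t = c].
Let coin_set (s : bool) : set R := [set (s : nat)%:R].

Let ge_setE c : ge_set c = if c == 0%N then setT else `]c%:R * h, +oo[%classic.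
Proof.
apply/seteqP; split => t; rewrite /ge_set /= (gap_ge h0); case: eqP => //= _;
by rewrite in_itv /= andbT.
Qed.

Let eq_setE c : eq_set c = ge_set c `\` ge_set c.+1.
Proof.
apply/seteqP; split => t; rewrite /eq_set /ge_set /=; first by move=> ->; rewrite leqnn ltnn.
by move=> []; lia.
Qed.

Let mge c : measurable (ge_set c).
Proof. by rewrite ge_setE; case: eqP. Qed.

Let meq c : measurable (eq_set c).
Proof. by rewrite eq_setE; exact: measurableD. Qed.

Let mcoin s : measurable (coin_set s).
Proof. exact: measurable_set1. Qed.

Let mpre j A : measurable A -> measurable (X j @^-1` A).
Proof. by move=> mA; rewrite -[_ @^-1` _]setTI; exact: mX. Qed.

Let P_ge x i c : P (X (inr (x, i)) @^-1` ge_set c) = (r ^+ c)%:E.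
Proof.
rewrite ge_setE; case: eqP => [->|/eqP c0].
  by rewrite preimage_setT probability_setT expr0.
have -> : X (inr (x, i)) @^-1` `]c%:R * h, +oo[%classic =
    ~` [set w | tau x i w <= c%:R * h].
  apply/seteqP; split => w /=; rewrite in_itv /= andbT ltNge; first by move/negP.
  by move=> H; apply/negP.
rewrite probability_setC; last first.
  by have := mpre (inr (x, i)) (measurable_itv `]-oo, c%:R * h]);
    congr (measurable _); apply/seteqP; split => w /=; rewrite in_itv.
rewrite Ptau ltNge mulr_ge0 //; last exact: ltW.
rewrite -EFinB; congr (_%:E).
by rewrite opprB addrC subrK /r -expRM_natl mulrN.
Qed.

Let P_eq x i c : P (X (inr (x, i)) @^-1` eq_set c) = (r ^+ c * (1 - r))%:E.
Proof.
have -> : X (inr (x, i)) @^-1` eq_set c =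
    (X (inr (x, i)) @^-1` ge_set c) `\` (X (inr (x, i)) @^-1` ge_set c.+1).
  by rewrite eq_setE.
rewrite measureD; [|exact: mpre|exact: mpre|]; last first.
  by apply: le_lt_trans (probability_le1 P (mpre _ (mge c))) _; rewrite ltry.
rewrite -preimage_setI (_ : ge_set c `&` ge_set c.+1 = ge_set c.+1); last first.
  by apply/setIidr => t; exact: ltnW.
have := P_ge x i c; have := P_ge x i c.+1 => /= -> ->.
by rewrite -EFinB exprS; congr (_%:E); ring.
Qed.

Let P_coin x i s : P (X (inl (x, i)) @^-1` coin_set s) = (if s then p else 1 - p)%:E.
Proof.
have E : [set w | B x i w] = X (inl (x, i)) @^-1` coin_set true.
  apply/seteqP; split => w; rewrite /coin_set /=; first by move=> ->.
  by case: (B x i w) => // /eqP; rewrite eq_sym oner_eq0.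
case: s; first by rewrite -E PB.
have -> : X (inl (x, i)) @^-1` coin_set false = ~` (X (inl (x, i)) @^-1` coin_set true).
  apply/seteqP; split => w; rewrite /coin_set /=; case: (B x i w) => //=.
    by move=> /eqP; rewrite oner_eq0.
  by move=> _ /eqP; rewrite eq_sym oner_eq0.
rewrite probability_setC; last exact: mpre.
by rewrite -E [X in (1 - X)%E]PB -EFinB.
Qed.

Fixpoint constraints (x : site d) i c (a : seq (option bool)) :
    seq (((site d * nat) + (site d * nat)) * set R) :=
  match a with
  | [::] => [:: (inr (x, i), ge_set c)]
  | None :: a' => constraints x i c.+1 a'
  | Some s :: a' =>
      [:: (inr (x, i), eq_set c), (inl (x, i), coin_set s) & constraints x i.+1 0 a']
  end.

Let event_of cs := \big[setI/setT]_(u <- cs) (X u.1 @^-1` u.2).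

Let event_constraints x i c a w : event_of (constraints x i c a) w <->
  symbols_match (fun i => gap h (tau x i w)) (fun i => B x i w) i c a.
Proof.
rewrite /event_of; elim: a i c => [|[s|] a IH] i c /=.
- by rewrite big_seq1.
- rewrite !big_cons /=; split.
    move=> [/= -> [cs /IH ->]]; rewrite eqxx andbT /=.
    move: cs; rewrite /coin_set /= => /eqP; rewrite eqr_nat; by case: (B x i w); case: s.
  by move=> /and3P[/eqP gc /eqP Bs /IH]; split=> //; split=> //; rewrite /coin_set /= Bs.
- exact: IH.
Qed.

Let constraints_index x i c a j : j \in unzip1 (constraints x i c a) ->
  exists2 m, (i <= m)%N & (j = inl (x, m)) \/ (j = inr (x, m)).
Proof.
elim: a i c => [|[s|] a IH] i c /=.
- by rewrite inE => /eqP ->; exists i => //; right.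
- rewrite !inE => /or3P[/eqP ->|/eqP ->|/IH[m im jm]].
  + by exists i => //; right.
  + by exists i => //; left.
  + by exists m => //; exact: ltnW.
- exact: IH.
Qed.

Let constraints_uniq x i c a : uniq (unzip1 (constraints x i c a)).
Proof.
elim: a i c => [//|[s|] a IH] i c //=.
rewrite inE negb_or /= IH andbT.
apply/andP; split; apply/negP => /constraints_index[m im [] // [] im'];
by rewrite im' ltnn in im.
Qed.

Let constraints_measurable x i c a : forall u, List.In u (constraints x i c a) ->
  measurable u.2.
Proof.
elim: a i c => [|[s|] a IH] i c u /=.
- by move=> [<-|[]]; exact: mge.
- by move=> [<-|[<-|/IH //]]; [exact: meq|exact: mcoin].
- exact: IH.
Qed.

(** Lack of memory: the factor [r ^+ c] pays for the rows already elapsed in the pending gap, and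
    each further silent row multiplies it by [r]. *)
Let constraints_prob x i c a :
  (\big[*%E/1%E]_(u <- constraints x i c a) P (X u.1 @^-1` u.2) =
   (r ^+ c * \prod_(s <- a) symbol_weight s)%:E)%E.
Proof.
elim: a i c => [|[s|] a IH] i c /=.
- by rewrite big_seq1 P_ge big_nil mulr1.
- rewrite !big_cons P_eq P_coin IH -!EFinM expr0; congr (_%:E); rewrite /=; ring.
- by rewrite IH big_cons exprS; congr (_%:E); rewrite /=; ring.
Qed.

(** Independence is stated for a family of sets indexed by all variables, so a list of constraints
    is turned into a table with the full set as default. *)
Let lookup (cs : seq (((site d * nat) + (site d * nat)) * set R)) :=
  foldr (fun u A j => if j == u.1 then u.2 else A j) (fun=> setT) cs.

Let big_lookup (I : Type) (idx : I) (op : I -> I -> I) (F : _ -> set R -> I) cs :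
  uniq (unzip1 cs) ->
  \big[op/idx]_(j <- unzip1 cs) F j (lookup cs j) = \big[op/idx]_(u <- cs) F u.1 u.2.
Proof.
elim: cs => [|u cs IH] /=; first by rewrite !big_nil.
move=> /andP[ucs uq]; rewrite !big_cons eqxx; congr (op _ _); rewrite -IH //.
apply: eq_big_seq => j jcs; case: eqP => // ju.
by rewrite -ju jcs in ucs.
Qed.

Let measurable_lookup cs : (forall u, List.In u cs -> measurable u.2) ->
  forall j, measurable (lookup cs j).
Proof.
elim: cs => [|u cs IH] H j; first exact: measurableT.
change (measurable (if j == u.1 then u.2 else lookup cs j)).
case: (j =P u.1) => _; first by apply: H; left.
by apply: IH => v vcs; apply: H; right.
Qed.

Let event_prob cs : uniq (unzip1 cs) -> (forall u, List.In u cs -> measurable u.2) ->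
  P (event_of cs) = \big[*%E/1%E]_(u <- cs) P (X u.1 @^-1` u.2).
Proof.
move=> ucs mcs; rewrite /event_of -(big_lookup _ _ (fun j A => X j @^-1` A)) //.
rewrite -(big_lookup _ _ (fun j A => P (X j @^-1` A))) // -bigcap_seq.
by apply: indep.2 => //; exact: measurable_lookup.
Qed.

Let event_measurable cs : (forall u, List.In u cs -> measurable u.2) ->
  measurable (event_of cs).
Proof.
elim: cs => [|u cs IH] H; rewrite /event_of ?big_nil // big_cons.
apply: measurableI; first by apply: mpre; apply: H; left.
by apply: IH => v vcs; apply: H; right.
Qed.

Let history := site d -> seq (option bool).

Let cyl (H : history) := [set w | forall x, x \in V ->
  forall k, (k < size (H x))%N -> symbol x k w = nth None (H x) k].

Let cylE H : cyl H = event_of (flatten [seq constraints x 0 0 (H x) | x <- V]).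
Proof.
apply/seteqP; split => w.
  rewrite /cyl /event_of /=; elim: V => [|x s IH] Hw; first by rewrite big_nil.
  rewrite /= big_cat; split; last by apply: IH => y ys; apply: Hw; rewrite inE ys orbT.
  apply/event_constraints/symbols_matchP => // k; apply: Hw; exact: mem_head.
rewrite /cyl /event_of /=; elim: V => [//|x s IH] /=.
rewrite big_cat => -[/event_constraints/symbols_matchP Hx /IH Hs] y.
by rewrite inE => /orP[/eqP ->|/Hs]; [exact: Hx|].
Qed.

Let flat_measurable H s : forall u,
  List.In u (flatten [seq constraints x 0 0 (H x) | x <- s]) -> measurable u.2.
Proof.
elim: s => [//|x s IH] u /=.
by move=> /List.in_app_iff[/constraints_measurable|/IH].
Qed.

Let flat_uniq (H : history) s : uniq s ->
  uniq (unzip1 (flatten [seq constraints x 0 0 (H x) | x <- s])).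
Proof.
elim: s => [//|x s IH] /andP[xs us] /=; rewrite /unzip1 map_cat cat_uniq.
rewrite constraints_uniq IH // andbT /=; apply/hasPn => j js; apply/negP.
move=> /constraints_index[m _ jx]; move/negP: xs; apply.
have : exists2 y, y \in s & exists m', j = inl (y, m') \/ j = inr (y, m').
  elim: s {IH us} js => [//|y s IH] /=; rewrite map_cat mem_cat => /orP[|/IH].
    by move=> /constraints_index[m' _ jy]; exists y; rewrite ?mem_head //; exists m'.
  by move=> [z zs jz]; exists z => //; rewrite inE zs orbT.
move=> [y ys [m' jy]]; case: jx jy => -> [] // [] -> _ //.
Qed.

Let cyl_measurable H : measurable (cyl H).
Proof. by rewrite cylE; apply: event_measurable; exact: flat_measurable. Qed.

Let cyl_prob H : P (cyl H) = (\prod_(x <- V) \prod_(s <- H x) symbol_weight s)%:E.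
Proof.
rewrite cylE event_prob; [|exact: flat_uniq|exact: flat_measurable].
elim: V => [|x s IH]; first by rewrite !big_nil.
by rewrite /= big_cat big_cons EFinM -IH constraints_prob expr0 mul1r.
Qed.

Let extend (H : history) y s : history :=
  fun x => if x == y then rcons (H x) s else H x.

Let extend_bump H y s : (fun x => size (extend H y s x)) =1 count_succ (fun x => size (H x)) y.
Proof. by move=> x; rewrite /extend /count_succ; case: eqP => //; rewrite size_rcons. Qed.

Let word_symbols_ext c c' L w : c =1 c' -> word_symbols c L w = word_symbols c' L w.
Proof. by move=> /funext ->. Qed.

Let cyl_extend H y s : y \in V ->
  cyl (extend H y s) = cyl H `&` [set w | symbol y (size (H y)) w = s].
Proof.
move=> yV; apply/seteqP; split => w.
  move=> Hw; split=> /= [x xV k kx|].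
    rewrite Hw // /extend; case: eqP => // _; last by rewrite size_rcons ltnS ltnW.
    by rewrite nth_rcons kx.
  rewrite Hw //; rewrite /extend eqxx ?size_rcons // nth_rcons ltnn eqxx //.
move=> [Hw Hs] x xV k; rewrite /extend; case: eqP => [->|_]; last exact: Hw.
rewrite size_rcons ltnS leq_eqVlt => /orP[/eqP ->|kx].
  by rewrite nth_rcons ltnn eqxx.
by rewrite nth_rcons kx; apply: Hw.
Qed.

(** The rows of each site are revealed in order, so reading one more letter extends the history of
    one site, and a prescribed word remains a cylinder of histories. *)
Let cyl_word (L : seq (site d)) : {subset L <= V} -> forall a H, size a = size L ->
  exists H', cyl H `&` [set w | word_symbols (fun x => size (H x)) L w = a] = cyl H' /\
  \prod_(x <- V) \prod_(s <- H' x) symbol_weight s =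
  (\prod_(x <- V) \prod_(s <- H x) symbol_weight s) * \prod_(s <- a) symbol_weight s.
Proof.
elim: L => [|y L IH] LV [|s a] H //= sa.
  by exists H; split; [apply/seteqP; split => // w []|rewrite big_nil mulr1].
have yV : y \in V by apply: LV; exact: mem_head.
have LV' : {subset L <= V} by move=> z zL; apply: LV; rewrite inE zL orbT.
have [H' [cE pE]] := IH LV' a (extend H y s) (succn_inj sa).
exists H'; split.
  rewrite -cE cyl_extend //; apply/seteqP; split => w /=.
    move=> [Hw [<- wa]]; split=> //; rewrite -wa; apply: word_symbols_ext.
    exact: extend_bump.
  move=> [[Hw <-] wa]; split=> //; congr (_ :: _); rewrite -wa.
  by apply: word_symbols_ext => x; rewrite extend_bump.
rewrite pE big_cons mulrA; congr (_ * _).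
rewrite (bigD1_seq y) //= [in RHS](bigD1_seq y) //= /extend eqxx -cats1 big_cat big_seq1.
rewrite mulrAC; congr (_ * _ * _); apply: eq_bigr => x /negPf xy.
by rewrite xy.
Qed.

Lemma word_symbols_law (L : seq (site d)) : {subset L <= V} -> forall F : seq (option bool) -> R,
  measurable_fun setT (fun w => F (word_symbols (fun=> 0%N) L w)) /\
  (\int[P]_w (F (word_symbols (fun=> 0%N) L w))%:E =
   (iid_mean symbol_weight (size L) F)%:E)%E.
Proof.
move=> LV; have key a : (size a <= size L)%N -> exists H,
    [set w | take (size a) (word_symbols (fun=> 0%N) L w) = a] = cyl H /\
    \prod_(x <- V) \prod_(s <- H x) symbol_weight s = \prod_(s <- a) symbol_weight s.
  move=> aL; have LV' : {subset take (size a) L <= V} by move=> x /mem_take /LV.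
  have [|H [cE pE]] := cyl_word LV' (a := a) (fun=> [::]); first by rewrite size_takel.
  exists H; rewrite pE -cE big1 ?mul1r => [|x _]; last by rewrite big_nil.
  split=> //; apply/seteqP; split => w /=; rewrite take_word_symbols; last by case.
  by split.
apply: integral_iid => [w|a /key[H [-> _]]|a /key[H [-> <-]]].
- exact: size_word_symbols.
- exact: cyl_measurable.
- exact: cyl_prob.
Qed.

End RingLaw.

(** * The discrete chain and the influence of the boundary *)

Section IidMean.
Variables (R : realType) (S : finType) (wt : S -> R).
Hypotheses (wt_ge0 : forall s, 0 <= wt s) (wt_sum : \sum_s wt s = 1).
Local Notation iid_mean := (iid_mean wt).

Lemma iid_mean_le n F G : (forall a, size a = n -> F a <= G a) -> iid_mean n F <= iid_mean n G.
Proof.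
elim: n F G => [|n IH] F G FG /=; first exact: FG.
by apply: ler_sum => s _; apply: ler_wpM2l => //; apply: IH => a an; apply: FG; rewrite /= an.
Qed.

Lemma eq_iid_mean n F G : (forall a, size a = n -> F a = G a) -> iid_mean n F = iid_mean n G.
Proof.
by move=> FG; apply/le_anti/andP; split; apply: iid_mean_le => a /FG ->.
Qed.

Lemma iid_mean_rcons n F :
  iid_mean n.+1 F = iid_mean n (fun a => \sum_s wt s * F (rcons a s)).
Proof.
elim: n F => [//|n IH] F.
rewrite -[LHS]/(\sum_s wt s * iid_mean n.+1 (fun a => F (s :: a))).
by apply: eq_bigr => s _; rewrite IH.
Qed.

Lemma iid_mean_cst n c : iid_mean n (fun=> c) = c.
Proof.
by elim: n => [//|n IH] /=; rewrite -[RHS]mul1r -wt_sum mulr_suml;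
  apply: eq_bigr => s _; rewrite IH.
Qed.

Lemma iid_meanZ n c F : iid_mean n (fun a => c * F a) = c * iid_mean n F.
Proof.
elim: n F => [//|n IH] F /=; rewrite mulr_sumr; apply: eq_bigr => s _.
by rewrite IH mulrCA.
Qed.

Lemma iid_meanD n F G : iid_mean n (fun a => F a + G a) = iid_mean n F + iid_mean n G.
Proof.
elim: n F G => [//|n IH] F G /=; rewrite -big_split /=; apply: eq_bigr => s _.
by rewrite IH mulrDr.
Qed.

Lemma iid_mean_sum n (I : Type) (r : seq I) (F : I -> seq S -> R) :
  iid_mean n (fun a => \sum_(i <- r) F i a) = \sum_(i <- r) iid_mean n (F i).
Proof.
elim: r => [|i r IH].
  rewrite big_nil -[RHS](iid_mean_cst n 0); apply: eq_iid_mean => a _.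
  by rewrite big_nil.
rewrite big_cons -IH -iid_meanD; apply: eq_iid_mean => a _; by rewrite big_cons.
Qed.

Lemma iid_mean_catM m n F G :
  iid_mean (m + n) (fun a => F (take m a) * G (drop m a)) = iid_mean m F * iid_mean n G.
Proof.
elim: m F => [|m IH] F /=.
  by rewrite -iid_meanZ; apply: eq_iid_mean => a _; rewrite take0 drop0.
by rewrite mulr_suml; apply: eq_bigr => s _; rewrite -mulrA -IH.
Qed.

End IidMean.

(** * The chain as a function of its symbols, and the spread of the taint *)

Section Runs.
Variables (R : realType) (d : nat) (p h : R) (V : seq (site d)).
Hypotheses (p01 : 0 < p < 1) (h0 : 0 < h).
Local Notation cfg := (site d -> bool).
Local Notation wt := (symbol_weight p h).
Local Notation r := (expR (- h)).

Let r01 : 0 <= r <= 1.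
Proof. by rewrite expR_ge0 expR_le1 oppr_le0 ltW. Qed.

Lemma sum_option_bool (F : option bool -> R) :
  \sum_s F s = F None + (F (Some true) + F (Some false)).
Proof.
rewrite (bigD1 None) //= (bigD1 (Some true)) //= (bigD1 (Some false)) //= big1 ?addr0 //.
by case=> [[]|].
Qed.

Lemma symbol_weight_ge0 s : 0 <= wt s.
Proof.
case/andP: p01 => p0 p1; case/andP: r01 => r0 r1.
by case: s => [[]|] //=; rewrite mulr_ge0 // ?subr_ge0 // ltW.
Qed.

Lemma symbol_weight_sum : \sum_s wt s = 1.
Proof. by rewrite sum_option_bool /=; ring. Qed.

Definition apply_symbol (eta : cfg) y (s : option bool) : cfg :=
  if s is Some b then (if legal V eta y then flip eta y b else eta) else eta.

Fixpoint run (L : seq (site d)) (a : seq (option bool)) (eta : cfg) : cfg :=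
  match L, a with
  | y :: L', s :: a' => run L' a' (apply_symbol eta y s)
  | _, _ => eta
  end.

Lemma word_op_run L f eta :
  word_op p (1 - r) V xpred0 L f eta = iid_mean wt (size L) (fun a => f (run L a eta)).
Proof.
elim: L eta => [//|y L IH] eta /=; rewrite sum_option_bool /= /ring_op /avg !IH.
by case: ifP => _; ring.
Qed.

Lemma run_rcons L y a s eta : size a = size L ->
  run (rcons L y) (rcons a s) eta = apply_symbol (run L a eta) y s.
Proof. by elim: L a eta => [|z L IH] [|u a] eta //= [/IH ->]. Qed.

(* A tainted site may have been influenced by the spins outside [V]. *)
Definition tainted (t : cfg) x := (x \notin V) || t x.

(** Any ring next to a tainted neighbour taints, legal or not, and taint never heals. The taint is
    therefore a function of the rings alone, independent of the configuration. *)
Definition apply_taint (t : cfg) y (s : option bool) : cfg :=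
  if isSome s && [exists i, tainted t (site_sub_e y i)] then flip t y true else t.

Fixpoint run_taint (L : seq (site d)) (a : seq (option bool)) (t : cfg) : cfg :=
  match L, a with
  | y :: L', s :: a' => run_taint L' a' (apply_taint t y s)
  | _, _ => t
  end.

Lemma run_taint_rcons L y a s t : size a = size L ->
  run_taint (rcons L y) (rcons a s) t = apply_taint (run_taint L a t) y s.
Proof. by elim: L a t => [|z L IH] [|u a] t //= [/IH ->]. Qed.

(** Keeps the private row counters synchronised: when a site is read, every other one is at the same
    row or one ahead. *)
Definition balanced (L : seq (site d)) := forall L1 y L2, L = L1 ++ y :: L2 ->
  y \in V /\
  forall z, z \in V -> (count_mem y L1 <= count_mem z L1 <= (count_mem y L1).+1)%N.

Lemma balanced_rcons L y : balanced (rcons L y) -> balanced L.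
Proof.
move=> H L1 z L2 LE; apply: (H L1 z (rcons L2 y)); by rewrite LE rcons_cat.
Qed.

Lemma balanced_last L y : balanced (rcons L y) -> y \in V /\
  forall z, z \in V -> (count_mem y L <= count_mem z L <= (count_mem y L).+1)%N.
Proof. by move=> H; apply: (H L y [::]); rewrite cats1. Qed.

Definition depth_ge m x := forall z, lesite z x -> (dist z x < m)%N -> z \in V.

Let taint_mean L x := iid_mean wt (size L) (fun a => (tainted (run_taint L a xpred0) x)%:R).

(** A ring of [x] can import taint from [d] neighbours. Each is one level less deep, a factor 2, and
    may have been read once more, a factor [kappa]; the condition on [kappa] absorbs exactly
    this. *)
Lemma taint_mean_le (kappa : R) L x m : balanced L ->
  1 <= kappa -> 1 + 2 * (1 - r) * d%:R * kappa <= kappa -> depth_ge m x ->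
  taint_mean L x <= 2^-1 ^+ m * kappa ^+ count_mem x L.
Proof.
move=> + kap1 kap; case/andP: (r01) => r0 r1.
have q0 : 0 <= 1 - r by rewrite subr_ge0.
have W0 := symbol_weight_ge0; have W1 := symbol_weight_sum.
have half0 k : 0 <= (2^-1 : R) ^+ k by rewrite exprn_ge0 // invr_ge0.
have kap0 k : 0 <= kappa ^+ k by rewrite exprn_ge0 // (le_trans ler01).
have mean_le1 L' x' : taint_mean L' x' <= 1.
  rewrite -[leRHS](iid_mean_cst W1 (size L')); apply: iid_mean_le => // a _.
  by rewrite lern1 leq_b1.
elim/last_ind: L x m => [|L y IH] x m bL dx.
  rewrite /taint_mean /= expr0 mulr1 /tainted orbF; case: m dx => [|m] dx.
    by rewrite expr0 lern1 leq_b1.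
  by rewrite dx ?lesite_refl ?distxx //= half0.
have bL' := balanced_rcons bL; have [yV bal] := balanced_last bL.
case: m dx => [_|m dx]; first by rewrite expr0 mul1r (le_trans (mean_le1 _ _)) // exprn_ege1.
have stepE : taint_mean (rcons L y) x = iid_mean wt (size L) (fun a =>
    \sum_s wt s * (tainted (apply_taint (run_taint L a xpred0) y s) x)%:R).
  rewrite /taint_mean size_rcons iid_mean_rcons; apply: eq_iid_mean => // a aL.
  by apply: eq_bigr => s _; rewrite run_taint_rcons.
rewrite stepE -cats1 count_cat /= addn0; case: (eqVneq y x) => [yx|yx]; last first.
  rewrite addn0; apply: le_trans (IH x m.+1 bL' dx); rewrite le_eqVlt; apply/orP; left.
  apply/eqP/eq_iid_mean => // a _.
  transitivity ((\sum_s wt s) * (tainted (run_taint L a xpred0) x)%:R); last by rewrite W1 mul1r.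
  rewrite mulr_suml; apply: eq_bigr => s _; congr (_ * (_ : bool)%:R); rewrite /apply_taint; case: ifP => // _.
  by rewrite /tainted /flip eq_sym (negPf yx).
rewrite addn1; pose k := count_mem x L.
apply: le_trans (_ : iid_mean wt (size L) (fun a => (tainted (run_taint L a xpred0) x)%:R +
   (1 - r) * \sum_i (tainted (run_taint L a xpred0) (site_sub_e x i))%:R) <= _).
  apply: iid_mean_le => // a _; rewrite sum_option_bool /= /apply_taint /= yx.
  set t := run_taint L a xpred0; set E := [exists i, _].
  have sE : E%:R <= \sum_i (tainted t (site_sub_e x i))%:R :> R.
    rewrite /E; case: existsP => [[i ti]|_]; last by apply: sumr_ge0.
    by rewrite (bigD1 i) //= ti lerDl sumr_ge0.
  have cE : (tainted (if E then flip t x true else t) x)%:R <= (tainted t x)%:R + E%:R :> R.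
    by case: (E); rewrite ?addr0 // /tainted /flip eqxx orbT lerDr.
  have p01' := p01; case/andP: p01' => p0 p1.
  set u := (tainted (if E then _ else _) x)%:R.
  rewrite -mulrDl (_ : (1 - r) * p + (1 - r) * (1 - p) = 1 - r); last ring.
  apply: le_trans (_ : r * (tainted t x)%:R + (1 - r) * ((tainted t x)%:R + E%:R) <= _).
    by rewrite lerD2l ler_wpM2l // cE.
  rewrite [leLHS](_ : _ = (tainted t x)%:R + (1 - r) * E%:R); last ring.
  by rewrite lerD2l ler_wpM2l.
rewrite iid_meanD iid_meanZ iid_mean_sum //.
apply: le_trans (_ : 2^-1 ^+ m.+1 * kappa ^+ k +
    (1 - r) * \sum_(i < d) 2^-1 ^+ m * kappa ^+ k.+1 <= _).
  apply: lerD; first exact: IH.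
  apply: ler_wpM2l => //; apply: ler_sum => i _; set z := site_sub_e x i.
  have dz : depth_ge m z.
    move=> u uz duz; apply: dx; first exact: lesite_trans (site_sub_e_le x i).
    by rewrite (dist_trans uz (site_sub_e_le x i)) dist_sub_e addn1.
  case: m dx dz => [|m] dx dz.
    apply: le_trans (mean_le1 _ _) _; by rewrite expr0 mul1r exprn_ege1.
  have zV : z \in V by apply: dx; [exact: site_sub_e_le|rewrite dist_sub_e].
  apply: le_trans (IH z m.+1 bL' dz) _; apply: ler_wpM2l => //.
  by apply: ler_weXn2l => //; have := bal z zV; rewrite yx => /andP[].
rewrite sumr_const card_ord -[_ *+ d]mulr_natl.
rewrite [leLHS](_ : _ = (1 + 2 * (1 - r) * d%:R * kappa) * (2^-1 ^+ m.+1 * kappa ^+ k)).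
  rewrite [leRHS](_ : _ = kappa * (2^-1 ^+ m.+1 * kappa ^+ k)).
    by apply: ler_wpM2r; rewrite ?mulr_ge0.
  by rewrite !exprS /k; ring.
by rewrite !exprS; field.
Qed.

End Runs.

(** * Comparison with the continuous-time trajectory *)

Section RingRows.
Local Open Scope nat_scope.
Variables (g : nat -> nat) (b : nat -> bool).
Local Notation state := (ring_state g (0, 0)).

(** The rounded time of the [n]-th ring, in rows: for positive [n] that ring is read in row
    [ring_row n - 1]. *)
Definition ring_row n := \sum_(j < n) (g j).+1.

Definition ring_count k := (state k).1.

Lemma ring_rowS n : ring_row n.+1 = (ring_row n + g n).+1.
Proof. by rewrite /ring_row big_ord_recr /= addnS. Qed.

Lemma ring_stateP k : k = ring_row (state k).1 + (state k).2 /\ (state k).2 <= g (state k).1.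
Proof.
elim: k => [|k [kE le]]; first by rewrite /ring_row big_ord0.
rewrite /ring_state iterS -/(ring_state g (0, 0) k).
move: kE le; case: (state k) => i c /= kE le; rewrite /ring_step /=.
case: eqP => gc /=; first by rewrite ring_rowS gc kE addn0.
by rewrite kE addnS; split=> //; lia.
Qed.

Lemma ring_count_row k : ring_row (ring_count k) <= k < ring_row (ring_count k).+1.
Proof. by have [kE le] := ring_stateP k; rewrite ring_rowS /ring_count; lia. Qed.

Lemma ring_row_leq m n : m <= n -> ring_row m <= ring_row n.
Proof.
by move=> /subnKC <-; elim: (n - m) => [|k IH]; rewrite ?addn0 // addnS ring_rowS; lia.
Qed.

Lemma ring_count_uniq k n : ring_row n <= k < ring_row n.+1 -> ring_count k = n.
Proof.
move=> /andP[h1 h2]; have /andP[h3 h4] := ring_count_row k.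
by case: (ltngtP (ring_count k) n) => // kn; have := ring_row_leq kn; lia.
Qed.

Lemma ring_symbolE k :
  ring_symbol g b (0, 0) k = if k.+1 == ring_row (ring_count k).+1 then
    Some (b (ring_count k)) else None.
Proof.
have [kE le] := ring_stateP k; rewrite /ring_symbol ring_rowS /ring_count.
by congr (if _ then _ else _); lia.
Qed.

Lemma ring_countS k : ring_count k.+1 = ring_count k + isSome (ring_symbol g b (0, 0) k).
Proof.
have /andP[h1 h2] := ring_count_row k.
rewrite ring_symbolE; case: eqP => kE /=; apply: ring_count_uniq.
  by rewrite addn1; have := ring_rowS (ring_count k).+1; lia.
by rewrite addn0; lia.
Qed.

Lemma ring_count_leq k k' : k <= k' -> ring_count k <= ring_count k'.
Proof.
move=> kk'; rewrite leqNgt; apply/negP => /ring_row_leq.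
have := ring_count_row k; have := ring_count_row k'; lia.
Qed.

Lemma ring_symbol_row n : ring_symbol g b (0, 0) (ring_row n + g n) = Some (b n).
Proof.
have nE : ring_count (ring_row n + g n) = n.
  by apply: ring_count_uniq; rewrite ring_rowS; lia.
by rewrite ring_symbolE nE ring_rowS eqxx.
Qed.

End RingRows.

Section Agreement.
Variables (R : realType) (d : nat) (h : R) (V : seq (site d)).
Variables (dO : measure_display) (O : measurableType dO).
Variables (tau : site d -> nat -> O -> R) (B : site d -> nat -> O -> bool) (w : O).
Hypothesis h0 : 0 < h.
Variables (M N : nat) (zeta : config d) (e : R -> config d).

Local Notation sym x k := (symbol h tau B x k w).
Local Notation g x := (fun i => gap h (tau x i w)).
Local Notation T x n := (clock (fun u m => tau u m w) x n).

Definition well_separated :=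
  [/\ forall x n, x \in V -> (n < N.+2)%N -> 0 < tau x n w,
      forall x, x \in V -> (ring_count (g x) M <= N)%N,
      forall x k, x \in V -> (M <= k < M + N.+2)%N -> sym x k = None &
      forall x y k k', x \in V -> y \in V -> x != y ->
        (k < M + N.+2)%N -> (k' < M + N.+2)%N -> (k <= k' + N)%N -> (k' <= k + N)%N ->
        sym x k = None \/ sym y k' = None].

Hypothesis sep : well_separated.
Hypothesis traj : east_trajectory (fun x n => tau x n w) (fun x n => B x n w) zeta e.

Let clockS x n : T x n.+1 = T x n + tau x n w.
Proof. by rewrite /clock big_ord_recr. Qed.

Let clock_le x n : T x n <= (ring_row (g x) n)%:R * h.
Proof.
elim: n => [|n IH]; first by rewrite /clock /ring_row !big_ord0 mul0r.
rewrite clockS ring_rowS -addnS natrD mulrDl lerD //.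
exact: le_gap.
Qed.

Let clock_ge x n : x \in V -> (n <= N.+2)%N -> (ring_row (g x) n)%:R * h <= T x n + n%:R * h.
Proof.
move=> xV; elim: n => [|n IH] nN; first by rewrite /clock /ring_row !big_ord0 !mul0r addr0.
have [tau0 _ _ _] := sep.
have := gap_lt h0 (tau0 x n xV nN); have := IH (ltnW nN).
rewrite clockS ring_rowS -addnS natrD !mulrDl -!natr1 !mulrDl mul1r; lra.
Qed.

Let clock_gt x n : x \in V -> (n < N.+2)%N ->
  (ring_row (g x) n.+1)%:R * h < T x n.+1 + n.+1%:R * h.
Proof.
move=> xV nN; have [tau0 _ _ _] := sep.
have := gap_lt h0 (tau0 x n xV nN); have := clock_ge xV (ltnW nN).
rewrite clockS ring_rowS -addnS natrD !mulrDl -!natr1 !mulrDl mul1r; lra.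
Qed.

Let clock_ge0 x n : x \in V -> (n <= N.+2)%N -> 0 <= T x n.
Proof.
move=> xV; have [tau0 _ _ _] := sep; elim: n => [|n IH] nN; first by rewrite /clock big_ord0.
by rewrite clockS; apply: addr_ge0; [exact: IH (ltnW nN)|exact: ltW (tau0 _ _ xV nN)].
Qed.

Let row_lt_mul (m n : nat) : (m <= n)%N -> m%:R * h <= n%:R * h.
Proof. by move=> mn; rewrite ler_pM2r // ler_nat. Qed.

(* The last ring of [z] before row [k] and the first one after it enclose a time
   interval containing every ring of another site around row [k]. *)
Let ring_between y z k n : y \in V -> z \in V -> y != z -> (k < M)%N ->
  ring_count (g y) k = n -> sym y k != None -> forall kz, (k <= kz <= k.+1)%N ->
  T z (ring_count (g z) kz) < T y n.+1 /\ T y n.+1 < T z (ring_count (g z) kz).+1.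
Proof.
move=> yV zV yz kM nE symy kz /andP[kkz kzk].
have [tau0 few _ apart] := sep.
have rowy : ring_row (g y) n.+1 = k.+1.
  by move: symy; rewrite /symbol ring_symbolE nE; case: (k.+1 =P _) => [->|_]; rewrite ?eqxx.
have nN : (n < N.+1)%N.
  by rewrite ltnS -nE; apply: leq_trans (few y yV); apply: ring_count_leq => //; exact: ltnW.
have Ty1 : (k.+1)%:R * h < T y n.+1 + n.+1%:R * h by rewrite -rowy clock_gt // ltnW.
have Ty2 : T y n.+1 <= k.+1%:R * h by rewrite -rowy clock_le.
have rows_apart k' : sym z k' != None -> (k' < M + N.+2)%N ->
    (k' + N < k)%N \/ (k + N < k')%N.
  move=> symz k'M; have [k1|k1] := leqP k (k' + N); last by left.
  have [k2|k2] := leqP k' (k + N); last by right.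
  have [|/eqP|/eqP] // := apart y z k k' yV zV yz _ k'M k1 k2; first by lia.
    by rewrite (negPf symy).
  by rewrite (negPf symz).
set c := ring_count (g z) kz.
have := ring_count_row (g z) kz; rewrite -/c => /andP[row1 row2].
have cN : (c <= N)%N by apply: leq_trans (few z zV); apply: ring_count_leq; lia.
split.
  case: c row1 row2 cN => [|c] row1 _ cN.
    have T0 : T z 0 = 0 by rewrite /clock big_ord0.
    rewrite T0 clockS; have := clock_ge0 yV (leqW (ltnW nN) : (n <= N.+2)%N).
    by have := tau0 y n yV (leqW nN); lra.
  have symz : sym z (ring_row (g z) c + g z c) != None by rewrite /symbol ring_symbol_row.
  have rowS : ring_row (g z) c.+1 = (ring_row (g z) c + g z c).+1 by rewrite ring_rowS.
  have [|kz1|kz1] := rows_apart _ symz; [lia| |lia].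
  have Tz := clock_le z c.+1; rewrite rowS in Tz.
  have : ((ring_row (g z) c + g z c).+1 + N)%:R * h <= k%:R * h by apply: row_lt_mul; lia.
  have : (n.+1)%:R * h <= (N.+1)%:R * h by apply: row_lt_mul.
  move: Tz Ty1; rewrite natrD !mulrDl -!natr1 !mulrDl !mul1r; lra.
have symz : sym z (ring_row (g z) c + g z c) != None by rewrite /symbol ring_symbol_row.
have Tz := clock_gt zV (leq_trans cN (leqnSn _) : (c < N.+2)%N); rewrite ring_rowS in Tz.
have far : (k + N < ring_row (g z) c + g z c)%N.
  case: (ltnP (ring_row (g z) c + g z c) (M + N.+2)) => [lt|]; last lia.
  have [] // := rows_apart _ symz lt; move: row2; rewrite ring_rowS; lia.
have : (k.+1 + N.+1)%:R * h <= (ring_row (g z) c + g z c).+1%:R * h.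
  by apply: row_lt_mul; lia.
have : (c.+1)%:R * h <= (N.+1)%:R * h by apply: row_lt_mul.
rewrite natrD mulrDl; lra.
Qed.

Let left_valueE z t0 n (v : bool) : T z n < t0 -> t0 < T z n.+1 ->
  left_value e z t0 v <-> e (T z n) z = v.
Proof.
move=> zt tz; have [_ [const _]] := traj; split.
  move=> [eps [eps0 H]]; set s := (Num.max (t0 - eps) (T z n) + t0) / 2.
  have m1 : t0 - eps <= Num.max (t0 - eps) (T z n) by rewrite le_max lexx.
  have m2 : T z n <= Num.max (t0 - eps) (T z n) by rewrite le_max lexx orbT.
  have m3 : Num.max (t0 - eps) (T z n) < t0 by rewrite gt_max zt andbT; lra.
  by rewrite -(const z n s) ?H // /s; lra.
move=> ev; exists (t0 - T z n); split; first lra.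
by move=> s s1 s2; rewrite -ev; apply: const; lra.
Qed.

Let cnt0 : site d -> nat := fun=> 0%N.

Lemma word_symbols_rcons cnt L y :
  word_symbols h tau B cnt (rcons L y) w =
  rcons (word_symbols h tau B cnt L w) (sym y (cnt y + count_mem y L)).
Proof.
elim: L cnt => [|z L IH] cnt /=; first by rewrite addn0.
rewrite IH; congr (_ :: rcons _ (sym y _)); rewrite /count_succ [z == y]eq_sym.
by case: (y == z); rewrite /= ?addSn ?add0n ?addnS.
Qed.

(** Induction on the last letter [y]. An untainted [y] that rings has all its lower neighbours in
    [V] and untainted, so the chain and the trajectory take the same decision as soon as they see
    the same zeros there. *)
Lemma run_agrees L : balanced V L -> (forall x, x \in V -> (count_mem x L <= M)%N) ->
  let a := word_symbols h tau B cnt0 L w in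
  forall x, x \in V -> ~~ tainted V (run_taint V L a xpred0) x ->
  run V L a zeta x = e (T x (ring_count (g x) (count_mem x L))) x.
Proof.
have [e0 [_ jump]] := traj.
elim/last_ind: L => [|L y IH] bL cM a x xV.
  by move=> _; rewrite /= /clock big_ord0 e0.
have bL' := balanced_rcons bL; have [yV bal] := balanced_last bL.
have cL : count_mem y (rcons L y) = (count_mem y L).+1 by rewrite -cats1 count_cat /= eqxx addn1.
have cL' z : y != z -> count_mem z (rcons L y) = count_mem z L.
  by move=> yz; rewrite -cats1 count_cat /= (negPf yz) !addn0.
have {}IH := IH bL' _; set a' := word_symbols h tau B cnt0 L w in IH.
have szL : size a' = size L by rewrite size_word_symbols.
have {}IH z : z \in V -> ~~ tainted V (run_taint V L a' xpred0) z ->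
    run V L a' zeta z = e (T z (ring_count (g z) (count_mem z L))) z.
  apply: IH => u uV; apply: leq_trans (cM u uV).
  by rewrite -cats1 count_cat leq_addr.
rewrite /a word_symbols_rcons -/a' run_taint_rcons // run_rcons // add0n.
set k := count_mem y L; set t := run_taint V L a' xpred0 in IH *.
set eta := run V L a' zeta in IH *.
have kM : (k < M)%N by have := cM y yV; rewrite cL.
case: (eqVneq y x) => [yx|yx]; last first.
  rewrite (cL' x yx) => nt.
  have -> : apply_symbol V eta y (sym y k) x = eta x.
    rewrite /apply_symbol; case: (sym y k) => // s; case: ifP => // _.
    by rewrite /flip eq_sym (negPf yx).
  apply: IH => //; apply: contra nt; rewrite /apply_taint; case: ifP => // _.
  by rewrite /tainted /flip eq_sym (negPf yx).
rewrite -yx cL -/k {x xV yx}.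
set n := ring_count (g y) k.
have := ring_countS (g y) (fun i => B y i w) k; rewrite -/(sym y k) -/n.
have symE : sym y k = if k.+1 == ring_row (g y) n.+1 then Some (B y n w) else None.
  by rewrite /symbol ring_symbolE.
case sE : (sym y k) => [s|] /=; last first.
  by rewrite addn0 => ->; rewrite /apply_taint /= => /(IH y yV).
rewrite addn1 => -> nt.
have sB : s = B y n w by move: symE; rewrite sE; case: eqP => // _ [].
have nbr i : ~~ tainted V t (site_sub_e y i).
  move: nt; rewrite /apply_taint /=; case: existsP => [_|ne _].
    by rewrite /tainted /flip eqxx orbT.
  by apply/negP => ti; apply: ne; exists i.
have {}nt : ~~ tainted V t y.
  move: nt; rewrite /apply_taint /=; case: ifP => // _.
  by rewrite /tainted /flip eqxx orbT.
have nbrV i : site_sub_e y i \in V.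
  by have := nbr i; rewrite /tainted negb_or negbK => /andP[].
(* The neighbour may or may not have been read already in the current pass; [ring_between] covers
   both counts allowed by [bal]. *)
have lv i : left_value e (site_sub_e y i) (T y n.+1) false <-> eta (site_sub_e y i) = false.
  set z := site_sub_e y i.
  have yz : y != z by rewrite eq_sym; case/andP: (site_sub_e_lt y i).
  have sy : sym y k != None by rewrite sE.
  have [t1 t2] := ring_between yV (nbrV i) yz kM erefl sy (bal z (nbrV i)).
  by rewrite (left_valueE _ t1 t2) (IH z (nbrV i) (nbr i)).
rewrite jump /apply_symbol /flip.
have -> : `[< exists i, left_value e (site_sub_e y i) (T y n.+1) false >] = legal V eta y.
  apply/asboolP/existsP => -[i]; first by move=> /lv ei; exists i; rewrite nbrV ei.
  by move=> /andP[_ /negbTE ei]; exists i; apply/lv.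
by case: ifP => _; rewrite ?eqxx ?sB // (IH y yV nt).
Qed.

(** Rounding is upwards, so the rings counted before row [M] have really occurred by [t0], and the
    silent rows after [M] prevent the next one from having occurred. *)
Lemma trajectory_agrees L t0 : balanced V L -> (forall x, x \in V -> count_mem x L = M) ->
  M%:R * h <= t0 < M.+1%:R * h ->
  let a := word_symbols h tau B cnt0 L w in
  forall x, x \in V -> ~~ tainted V (run_taint V L a xpred0) x ->
  e t0 x = run V L a zeta x.
Proof.
move=> bL cM /andP[Mt tM] a x xV nt.
rewrite run_agrees // => [|y yV]; last by rewrite cM.
rewrite cM //; have [_ few none _] := sep; have [_ [const _]] := traj.
set c := ring_count (g x) M; have cN : (c <= N)%N := few x xV.
have := ring_count_row (g x) M; rewrite -/c => /andP[row1 row2]; apply: const.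
  apply: le_trans (clock_le x c) _; apply: le_trans Mt; exact: row_lt_mul.
have symx : sym x (ring_row (g x) c + g x c) != None by rewrite /symbol ring_symbol_row.
have far : (M + N.+2 <= ring_row (g x) c + g x c)%N.
  rewrite leqNgt; apply/negP => lt; move/negP: symx; apply.
  by apply/eqP/none => //; move: row2 lt; rewrite ring_rowS; lia.
apply: lt_le_trans tM _.
have := clock_gt xV (leq_trans cN (leqnSn _) : (c < N.+2)%N); rewrite ring_rowS.
have : (M.+1 + N.+1)%:R * h <= (ring_row (g x) c + g x c).+1%:R * h.
  by apply: row_lt_mul; lia.
have : (c.+1)%:R * h <= (N.+1)%:R * h by apply: row_lt_mul.
rewrite natrD mulrDl; lra.
Qed.

End Agreement.

(** * Union bounds and comparison of means off a small event *)

Section ProbabilityBounds.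
Variables (R : realType) (dO : measure_display) (O : measurableType dO) (P : probability O R).

Definition small (c : R) (A : set O) := measurable A /\ (P A <= c%:E)%E.

Lemma small_bigcup (I : choiceType) (s : seq I) (A : I -> set O) (c : R) :
  (forall i, i \in s -> small c (A i)) ->
  small ((size s)%:R * c) (\bigcup_(i in [set` s]) A i).
Proof.
rewrite /small bigcup_seq; elim: s => [|i s IH] H; first by rewrite big_nil measure0 mul0r.
have [mA PA] := H i (mem_head _ _).
have [j js|mU PU] := IH; first by apply: H; rewrite inE js orbT.
rewrite big_cons; split; first exact: measurableU.
apply: le_trans (measureU2 _ mA mU) _.
by rewrite -natr1 mulrDl mul1r addrC EFinD; exact: leeD.
Qed.

Lemma smallU c c' A B : small c A -> small c' B -> small (c + c') (A `|` B).
Proof.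
move=> [mA PA] [mB PB]; split; first exact: measurableU.
by apply: le_trans (measureU2 _ mA mB) _; rewrite EFinD; exact: leeD.
Qed.

Lemma bounded_integrable (G : O -> R) C : measurable_fun setT G ->
  (forall w, `|G w| <= C) -> P.-integrable setT (EFin \o G).
Proof.
move=> mG GC; apply: (@le_integrable _ _ _ P setT _ _ (EFin \o cst C)) => //.
- exact/measurable_EFinP.
- by move=> w _ /=; rewrite lee_fin; apply: le_trans (GC w) (ler_norm _).
- exact: finite_measure_integrable_cst.
Qed.

Lemma integral_diff_le (G G' : O -> R) C c E :
  measurable_fun setT G -> measurable_fun setT G' -> 0 <= C ->
  (forall w, `|G w| <= C) -> (forall w, `|G' w| <= C) ->
  small c E -> {ae P, forall w, ~ E w -> G w = G' w} ->
  (`| \int[P]_w (G w)%:E - \int[P]_w (G' w)%:E | <= (2 * C * c)%:E)%E.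
Proof.
move=> mG mG' C0 GC G'C [mE PE] GG'.
rewrite -integralB_EFin //; [|exact: bounded_integrable GC|exact: bounded_integrable G'C].
have mD : measurable_fun setT (fun w => (G w)%:E - (G' w)%:E)%E.
  by apply: emeasurable_funB; exact/measurable_EFinP.
apply: le_trans (le_abse_integral P measurableT mD) _.
have mI : measurable_fun setT (fun w => (2 * C * \1_E w)%:E).
  by apply/measurable_EFinP/measurable_funM => //; exact: measurable_indic.
apply: le_trans (_ : (\int[P]_w (2 * C * \1_E w)%:E <= _)%E).
  apply: ae_ge0_le_integral => //.
  - exact: measurableT_comp.
  - by move=> w _; rewrite lee_fin !mulr_ge0.
  - apply: filterS GG' => w H _; rewrite indicE; case: (pselect (E w)) => Ew.
      rewrite mem_set // mulr1 -EFinB /= lee_fin.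
      by apply: le_trans (ler_normB _ _) _; rewrite mulr_natl mulr2n lerD.
    by rewrite memNset // mulr0 H // subee // abse0.
rewrite (_ : (fun w => _) = (fun w => (2 * C)%:E * (\1_E w)%:E)%E); last first.
  by apply/funext => w; rewrite EFinM.
rewrite ge0_integralZl_EFin ?mulr_ge0 //; last first.
  by apply/measurable_EFinP; exact: measurable_indic.
by rewrite integral_indic // setIT [leRHS]EFinM; apply: lee_wpmul2l => //; rewrite lee_fin mulr_ge0.
Qed.

End ProbabilityBounds.

Lemma mem_iota_window (k k' N : nat) : (k <= k' + N)%N -> (k' <= k + N)%N ->
  k' \in iota (k - N) (N + N.+1).
Proof. by rewrite mem_iota; lia. Qed.

(** * Probability that the discrete chain misrepresents the process *)

Section Discretisation.
Variables (R : realType) (d : nat) (p h : R) (dO : measure_display) (O : measurableType dO).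
Variables (P : probability O R) (tau : site d -> nat -> O -> R) (B : site d -> nat -> O -> bool).
Hypotheses (p01 : 0 < p < 1) (h0 : 0 < h).
Hypothesis indep : mutually_independent P
  (fun j : (site d * nat) + (site d * nat) => match j with
    | inl (x, n) => fun w => ((B x n w : nat)%:R : R)
    | inr (x, n) => tau x n end).
Hypothesis PB : forall x n, P [set w | B x n w] = p%:E.
Hypothesis Ptau : forall x n (s : R), P [set w | tau x n w <= s] =
  (if s < 0 then 0 else 1 - expR (- s))%:E.
Variable V : seq (site d).
Hypothesis uV : uniq V.

Local Notation wt := (symbol_weight p h).
Local Notation r := (expR (- h)).
Local Notation sym x k w := (symbol h tau B x k w).
Local Notation symbols L w := (word_symbols h tau B (fun=> 0%N) L w).
Local Notation g x w := (fun i => gap h (tau x i w)).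

Let wt_sum := symbol_weight_sum p h.
Let wt_ge0 := symbol_weight_ge0 p01 h0.

Let q0 : 0 <= 1 - r.
Proof. by rewrite subr_ge0 expR_le1 oppr_le0 ltW. Qed.

Let qh : 1 - r <= h.
Proof. by have := expR_ge1Dx (- h); lra. Qed.

Lemma symbols_event (L : seq (site d)) (Q : pred (seq (option bool))) : {subset L <= V} ->
  measurable [set w | Q (symbols L w)] /\
  P [set w | Q (symbols L w)] = (iid_mean wt (size L) (fun a => (Q a)%:R))%:E.
Proof.
move=> LV; have [mF IF] := word_symbols_law p01 h0 indep PB Ptau uV LV (fun a => (Q a)%:R).
have QE : [set w | Q (symbols L w)] = setT `&` (fun w => (Q (symbols L w))%:R : R) @^-1` [set 1].
  apply/seteqP; split => w /=; first by move=> ->.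
  by move=> [_]; case: (Q _) => //= /eqP; rewrite eq_sym oner_eq0.
have mQ : measurable [set w | Q (symbols L w)] by rewrite QE; exact: mF.
split => //; rewrite -IF; transitivity (P ([set w | Q (symbols L w)] `&` setT)).
  by rewrite setIT.
rewrite -integral_indic //.
apply: eq_integral => w _; rewrite indicE; congr ((_ : bool)%:R)%:E.
by apply/idP/idP; rewrite inE.
Qed.

Let mean_some n : iid_mean wt n.+1 (fun a => (isSome (last None a))%:R) = 1 - r.
Proof.
rewrite iid_mean_rcons -[RHS](iid_mean_cst wt_sum n); apply: eq_iid_mean => // a _.
by rewrite sum_option_bool !last_rcons /=; ring.
Qed.

Let symbol_last (L : seq (site d)) x w :
  last None (symbols (rcons L x) w) = sym x (count_mem x L) w.
Proof. by rewrite word_symbols_rcons last_rcons. Qed.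

Let count_nseq (x : site d) k : count_mem x (nseq k x) = k.
Proof. by rewrite count_nseq /= eqxx mul1n. Qed.

Lemma small_ring x k : x \in V -> small P h [set w | sym x k w != None].
Proof.
move=> xV; have LV : {subset rcons (nseq k x) x <= V}.
  by move=> y; rewrite mem_rcons inE mem_nseq => /orP[/eqP ->|/andP[_ /eqP ->]].
have [mE PE] := symbols_event (fun a => isSome (last None a)) LV.
have E : [set w | sym x k w != None] = [set w | isSome (last None (symbols (rcons (nseq k x) x) w))].
  by apply/seteqP; split => w /=; rewrite symbol_last count_nseq; case: (sym x k w).
rewrite E; split => //; rewrite PE size_rcons size_nseq lee_fin.
by rewrite mean_some.
Qed.

(** Reads [k.+1] rows of [x] and then [k'.+1] rows of [y] as one word: the two rings are the last
    letters of its two parts, which are independent. *)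
Lemma small_two_rings x y k k' : x \in V -> y \in V -> x != y ->
  small P (h * h) [set w | sym x k w != None /\ sym y k' w != None].
Proof.
move=> xV yV xy; set L1 := rcons (nseq k x) x; set L2 := rcons (nseq k' y) y.
have LV : {subset L1 ++ L2 <= V}.
  move=> z; rewrite mem_cat !mem_rcons !inE !mem_nseq.
  by move=> /orP[]/orP[/eqP ->|/andP[_ /eqP ->]].
pose Q (a : seq (option bool)) :=
  isSome (last None (take k.+1 a)) && isSome (last None (drop k.+1 a)).
have s1 : size L1 = k.+1 by rewrite size_rcons size_nseq.
have s2 : size L2 = k'.+1 by rewrite size_rcons size_nseq.
have [mE PE] := symbols_event Q LV.
have split_word cnt w : word_symbols h tau B cnt (L1 ++ L2) w =
    word_symbols h tau B cnt L1 w ++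
    word_symbols h tau B (fun z => cnt z + count_mem z L1)%N L2 w.
  elim: (L1) cnt => [|z L IH] cnt /=; first by under eq_fun do rewrite addn0.
  rewrite IH; congr (_ :: _ ++ word_symbols _ _ _ _ _ _); apply/funext => u.
  rewrite /count_succ eq_sym; case: (z == u); rewrite /= ?add0n //.
  by rewrite add1n addnS.
have E : [set w | sym x k w != None /\ sym y k' w != None] = [set w | Q (symbols (L1 ++ L2) w)].
  apply/seteqP; split => w; rewrite /= /Q split_word.
    rewrite take_size_cat ?drop_size_cat ?size_word_symbols //= symbol_last count_nseq.
    rewrite word_symbols_rcons last_rcons count_nseq.
    rewrite /L1 -cats1 count_cat /= (negPf xy) addn0 add0n.
    have -> : count_mem y (nseq k x) = 0%N by rewrite seq.count_nseq /= (negPf xy).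
    by rewrite add0n; case=> + +; case: (sym x k w); case: (sym y k' w).
  rewrite /= take_size_cat ?drop_size_cat ?size_word_symbols //= symbol_last count_nseq.
  rewrite word_symbols_rcons last_rcons count_nseq.
  rewrite /L1 -cats1 count_cat /= (negPf xy) addn0 add0n.
  have -> : count_mem y (nseq k x) = 0%N by rewrite seq.count_nseq /= (negPf xy).
  by rewrite add0n; case: (sym x k w); case: (sym y k' w).
rewrite E; split => //; rewrite PE size_cat s1 s2 lee_fin.
rewrite (eq_iid_mean wt_ge0 (G := fun a => (isSome (last None (take k.+1 a)))%:R *
  (isSome (last None (drop k.+1 a)))%:R)); last first.
  by move=> a _; rewrite /Q -mulnb natrM.
rewrite (iid_mean_catM wt_ge0 k.+1 k'.+1 (fun a => (isSome (last None a))%:R)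
  (fun a => (isSome (last None a))%:R)).
by rewrite !mean_some; exact: ler_pM.
Qed.

(** Markov's inequality for the number of rings, whose mean is at most [M%:R * h]. *)
Lemma small_many_rings x M N : x \in V ->
  small P (M%:R * h / N.+1%:R) [set w | (N < ring_count (g x w) M)%N].
Proof.
move=> xV; have LV : {subset nseq M x <= V} by move=> y; rewrite mem_nseq => /andP[_ /eqP ->].
have countE w k : ring_count (g x w) k = count isSome (symbols (nseq k x) w).
  elim: k => [//|k IH]; rewrite (ring_countS _ (fun i => B x i w)) IH.
  rewrite -[k.+1]addn1 nseqD cats1 word_symbols_rcons count_nseq add0n.
  by rewrite -cats1 count_cat /= addn0.
have [mE PE] := symbols_event (fun a => N < count isSome a)%N LV.
have E : [set w | (N < ring_count (g x w) M)%N] = [set w | (N < count isSome (symbols (nseq M x) w))%N].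
  by apply/seteqP; split => w /=; rewrite countE.
rewrite E; split => //; rewrite PE size_nseq lee_fin.
apply: le_trans (_ : iid_mean wt M (fun a => N.+1%:R^-1 * (count isSome a)%:R) <= _).
  apply: iid_mean_le => // a _; rewrite mulrC ler_pdivlMr ?ltr0n // -natrM ler_nat.
  by case: ltnP => H; rewrite ?mul1n ?mul0n.
rewrite iid_meanZ // mulrC ler_wpM2r ?invr_ge0 //.
apply: le_trans (_ : M%:R * (1 - r) <= _); last exact: ler_wpM2l.
elim: {LV mE PE E} M => [|M IH] /=; first by rewrite mul0r.
have addE c : iid_mean wt M (fun a => (c + count isSome a)%:R) =
    c%:R + iid_mean wt M (fun a => (count isSome a)%:R).
  rewrite -[X in X + _](iid_mean_cst wt_sum M) -iid_meanD.
  by apply: eq_iid_mean => // a _; rewrite natrD.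
rewrite sum_option_bool /= !addE.
set m := iid_mean _ _ _ in IH *.
rewrite [leLHS](_ : _ = m + (1 - r)); last ring.
by rewrite -[M.+1%:R]natr1 mulrDl mul1r lerD2r.
Qed.

Lemma small_nonpositive x n : small P 0 [set w | tau x n w <= 0].
Proof.
have mX : measurable_fun setT (tau x n) by exact: indep.1 (inr (x, n)).
split; last by rewrite Ptau ltxx oppr0 expR0 subrr.
rewrite (_ : [set w | _] = setT `&` tau x n @^-1` `]-oo, 0]); first exact: mX.
by apply/seteqP; split => w /=; rewrite in_itv //= => -[].
Qed.

Lemma uniq_repeat_count M x : x \in V -> count_mem x (repeat_word M V) = M.
Proof.
move=> xV; elim: M => [//|M IH].
by rewrite /repeat_word /= -/(repeat_word M V) count_cat IH count_uniq_mem // xV.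
Qed.

Lemma balanced_repeat M : balanced V (repeat_word M V).
Proof.
elim: M => [|M IH] L1 y L2; first by case: L1.
rewrite [repeat_word _ _]/repeat_word /= -/(repeat_word M V) => E.
have L1E : L1 = take (size L1) (V ++ repeat_word M V) by rewrite E take_size_cat.
have yE : y :: L2 = drop (size L1) (V ++ repeat_word M V) by rewrite E drop_size_cat.
case: (ltnP (size L1) (size V)) => LV.
  move: L1E yE; rewrite take_cat drop_cat LV => L1E yE.
  have := cat_take_drop (size L1) V; rewrite -L1E.
  rewrite (drop_nth y LV) in yE *; case: yE => <- _ VE.
  have yV : y \in V by rewrite -VE mem_cat mem_head orbT.
  split=> // z zV; move: uV; rewrite -VE cat_uniq => /and3P[u1 /hasPn nin _].
  rewrite !count_uniq_mem // (negPf (nin y (mem_head _ _))).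
  by case: (z \in L1).
move: L1E yE; rewrite take_cat drop_cat ltnNge LV /= => L1E yE.
have := cat_take_drop (size L1 - size V) (repeat_word M V); rewrite -yE => /esym WE.
have [yV bal] := IH _ _ _ WE; split=> // z zV; rewrite L1E !count_cat !(count_uniq_mem _ uV) zV yV.
by have := bal z zV; rewrite !add1n !ltnS.
Qed.

Section BadEvent.
Variables (M N D : nat) (s : seq (site d)).
Hypothesis sV : {subset s <= V}.
Hypothesis depth_s : forall x, x \in s -> depth_ge V D x.
Hypothesis h_small : 4 * h * d%:R <= 1.

Let W := repeat_word M V.

(** The first four pieces are the failures of [well_separated], the last is taint reaching [s]; they
    match the terms of [discretisation_error] in order. *)
Definition discretisation_event : set O :=
  (\bigcup_(x in [set` V]) \bigcup_(n in [set` iota 0 N.+2]) [set w | tau x n w <= 0]) `|`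
  (\bigcup_(x in [set` V]) [set w | (N < ring_count (g x w) M)%N]) `|`
  (\bigcup_(x in [set` V]) \bigcup_(k in [set` iota M N.+2]) [set w | sym x k w != None]) `|`
  (\bigcup_(x in [set` V]) \bigcup_(y in [set` V]) \bigcup_(k in [set` iota 0 (M + N.+2)])
     \bigcup_(k' in [set` iota (k - N) (N + N.+1)])
       [set w | x != y /\ sym x k w != None /\ sym y k' w != None]) `|`
  (\bigcup_(x in [set` s]) [set w | tainted V (run_taint V W (symbols W w) xpred0) x]).

Definition discretisation_error : R :=
  (size V)%:R * ((N.+2)%:R * 0) + (size V)%:R * (M%:R * h / N.+1%:R) +
  (size V)%:R * ((N.+2)%:R * h) +
  (size V)%:R * ((size V)%:R * ((M + N.+2)%:R * ((N + N.+1)%:R * (h * h)))) +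
  (size s)%:R * (2^-1 ^+ D * expR (4 * d%:R * (M%:R * h))).

Lemma small_tainted x : x \in s ->
  small P (2^-1 ^+ D * expR (4 * d%:R * (M%:R * h)))
    [set w | tainted V (run_taint V W (symbols W w) xpred0) x].
Proof.
move=> xs; have WV : {subset W <= V}.
  by move=> y; rewrite /W /repeat_word => /flattenP[L]; rewrite mem_nseq => /andP[_ /eqP ->].
have [mE PE] := symbols_event (fun a => tainted V (run_taint V W a xpred0) x) WV.
split => //; rewrite PE lee_fin.
have d0 : 0 <= d%:R :> R by [].
(* With $u=(1-r)d\le 1/4$, this value $1+4u$ is at most 2, whence $1+2u\kappa\le\kappa$; moreover
   $\kappa^M\le e^{4dMh}$, uniformly in [h] for a given total time. *)
pose kappa := 1 + 4 * (1 - r) * d%:R.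
have qd0 : 0 <= (1 - r) * d%:R by rewrite mulr_ge0.
have qd1 : 4 * ((1 - r) * d%:R) <= 1.
  apply: le_trans h_small; rewrite -mulrA ler_pM2l //; exact: ler_wpM2r.
have kap1 : 1 <= kappa by rewrite lerDl -mulrA mulr_ge0.
have kap2 : 1 + 2 * (1 - r) * d%:R * kappa <= kappa.
  rewrite /kappa -!mulrA lerD2l; set u := (1 - r) * d%:R in qd0 qd1 *.
  rewrite [leLHS](_ : _ = 2 * u * (1 + 4 * u)); last by rewrite /u; ring.
  apply: le_trans (_ : 2 * u * 2 <= _); last by lra.
  by apply: ler_wpM2l; lra.
apply: le_trans (taint_mean_le p01 h0 (@balanced_repeat M) kap1 kap2 (depth_s xs)) _.
rewrite uniq_repeat_count ?sV //; apply: ler_wpM2l; first by rewrite exprn_ge0 // invr_ge0.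
apply: le_trans (_ : expR (4 * (1 - r) * d%:R) ^+ M <= _).
  by rewrite lerXn2r ?nnegrE ?expR_ge0 ?expR_ge1Dx // (le_trans ler01).
rewrite -expRM_natl ler_expR.
rewrite [leLHS](_ : _ = 4 * d%:R * (M%:R * (1 - r))); last ring.
by apply: ler_wpM2l; rewrite ?mulr_ge0 //; apply: ler_wpM2l.
Qed.

Lemma small_discretisation_event : small P discretisation_error discretisation_event.
Proof.
have mem_eq (x : site d) : x \in [set` V] -> x \in V by rewrite inE.
apply: smallU; last by apply: small_bigcup => x xs; exact: small_tainted.
apply: smallU.
  apply: smallU; first apply: smallU.
  - apply: small_bigcup => x xV; rewrite -[X in X%:R](size_iota 0).
    by apply: small_bigcup => n _; exact: small_nonpositive.
  - by apply: small_bigcup => x xV; exact: small_many_rings.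
  - apply: small_bigcup => x xV; rewrite -[X in X%:R](size_iota M).
    by apply: small_bigcup => k _; exact: small_ring.
apply: small_bigcup => x xV; apply: small_bigcup => y yV.
rewrite -[X in X%:R * _](size_iota 0 (M + N.+2)); apply: small_bigcup => k _.
rewrite -[X in X%:R * _](size_iota (k - N) (N + N.+1)); apply: small_bigcup => k' _.
case: (eqVneq x y) => [_|xy].
  rewrite (_ : [set w | _] = set0); last by apply/seteqP; split => w // [].
  by split; rewrite // measure0 lee_fin mulr_ge0 ?ltW.
rewrite (_ : [set w | _] = [set w | sym x k w != None /\ sym y k' w != None]).
  exact: small_two_rings.
by apply/seteqP; split => w /=; [case|].
Qed.

Lemma good_run (eta : config d) (e : R -> config d) t0 w :
  ~ discretisation_event w -> M%:R * h <= t0 < M.+1%:R * h ->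
  east_trajectory (fun x n => tau x n w) (fun x n => B x n w) eta e ->
  forall x, x \in s -> e t0 x = run V W (symbols W w) eta x.
Proof.
move=> good t0M traj x xs.
have sep : well_separated h V tau B w M N.
  split=> [y n yV nN|y yV|y k yV kM|y z k k' yV zV yz kM k'M kk' k'k].
  - rewrite ltNge; apply/negP => H; apply: good; do 4!left; exists y => //.
    have ni : n \in iota 0 N.+2 by rewrite mem_iota.
    by exists n; [exact: ni|exact: H].
  - rewrite leqNgt; apply/negP => H; apply: good; do 3!left; right; exists y => //.
  - apply/eqP; apply/negPn/negP => H; apply: good; do 2!left; right; exists y => //.
    have ki : k \in iota M N.+2 by rewrite mem_iota.
    by exists k; [exact: ki|exact: H].
  - case: (eqVneq (sym y k w) None) => [|sy]; first by left.
    right; apply/eqP; apply/negPn/negP => H; apply: good; left; right.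
    have ki : k \in iota 0 (M + N.+2) by rewrite mem_iota.
    have ki' : k' \in iota (k - N) (N + N.+1) by exact: mem_iota_window.
    exists y => //; exists z => //; exists k; first exact: ki.
    by exists k'; [exact: ki'|].
apply: (trajectory_agrees h0 sep traj (@balanced_repeat M)) => //.
- by move=> y yV; exact: uniq_repeat_count.
- exact: sV.
- by apply/negP => H; apply: good; right; exists x.
Qed.

Lemma mean_word_op (f : config d -> R) C (eta : R -> O -> config d) (zeta : config d) t0 :
  0 <= C -> (forall e, `|f e| <= C) ->
  (forall e e' : config d, (forall x, x \in s -> e x = e' x) -> f e = f e') ->
  M%:R * h <= t0 < M.+1%:R * h ->
  measurable_fun setT (fun w => f (eta t0 w)) ->
  {ae P, forall w, east_trajectory (fun x n => tau x n w) (fun x n => B x n w) zeta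
     (fun t => eta t w)} ->
  (`| \int[P]_w (f (eta t0 w))%:E - (word_op p (1 - r) V xpred0 W f zeta)%:E |
    <= (2 * C * discretisation_error)%:E)%E.
Proof.
move=> C0 fC fs t0M mf traj; have WV : {subset W <= V}.
  by move=> y; rewrite /W /repeat_word => /flattenP[L]; rewrite mem_nseq => /andP[_ /eqP ->].
have [mF IF] := word_symbols_law p01 h0 indep PB Ptau uV WV (fun a => f (run V W a zeta)).
rewrite word_op_run -IF.
apply: (integral_diff_le mf mF C0 _ _ small_discretisation_event) => //.
apply: filterS traj => w traj good; apply: fs => x xs.
exact: (good_run good t0M traj xs).
Qed.

End BadEvent.

End Discretisation.

(** * Finite-range functions and boxes *)

Section CylinderFunctions.
Variables (R : realType) (d : nat).
Implicit Types (s : seq (site d)) (f : config d -> R).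

Definition local_to s f :=
  forall e e' : config d, (forall x, x \in s -> e x = e' x) -> f e = f e'.

Lemma local_insensitive s f : local_to s f -> insensitive [pred y | y \notin s] f.
Proof.
move=> fs y b e ys; apply: fs => x xs; rewrite /flip; case: eqP => // xy.
by move: ys; rewrite /= -xy xs.
Qed.

Lemma local_flip x s f b : local_to (x :: s) f -> local_to s (fun e => f (flip e x b)).
Proof.
move=> fs e e' ee'; apply: fs => y; rewrite inE /flip; case: eqP => //= _; exact: ee'.
Qed.

Lemma measurable_coordinate x b : measurable [set e : config d | e x = b].
Proof. by apply: sub_sigma_algebra; exists x, b. Qed.

Lemma measurable_local dO (O : measurableType dO) s f (Y : O -> config d) :
  local_to s f -> (forall x, x \in s -> measurable_fun setT (fun w => Y w x)) ->
  measurable_fun setT (fun w => f (Y w)).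
Proof.
elim: s f => [|x s IH] f fs mY.
  rewrite (_ : (fun w => f (Y w)) = cst (f (fun=> true))); first exact: measurable_cst.
  by apply/funext => w; apply: fs.
rewrite (_ : (fun w => f (Y w)) =
   (fun w => if Y w x then f (flip (Y w) x true) else f (flip (Y w) x false))).
  apply: measurable_fun_ifT; first exact: mY (mem_head _ _).
    by apply: (IH (fun e => f (flip e x true)));
      [exact: local_flip|move=> y ys; apply: mY; rewrite inE ys orbT].
  by apply: (IH (fun e => f (flip e x false)));
    [exact: local_flip|move=> y ys; apply: mY; rewrite inE ys orbT].
apply/funext => w; have E : Y w = flip (Y w) x (Y w x).
  by apply/funext => y; rewrite /flip; case: eqP => // ->.
by rewrite [in LHS]E; case: (Y w x).
Qed.

Lemma local_bounded s f : local_to s f -> exists C, forall e, `|f e| <= C.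
Proof.
elim: s f => [|x s IH] f fs; first by exists `|f (fun=> true)| => e; rewrite (fs e (fun=> true)).
have [C1 H1] := IH _ (local_flip true fs); have [C2 H2] := IH _ (local_flip false fs).
have C10 : 0 <= C1 by exact: le_trans (H1 (fun=> true)).
have C20 : 0 <= C2 by exact: le_trans (H2 (fun=> true)).
exists (C1 + C2) => e; have -> : e = flip e x (e x).
  by apply/funext => y; rewrite /flip; case: eqP => // ->.
case: (e x); first by apply: le_trans (H1 e) _; rewrite lerDl.
by apply: le_trans (H2 e) _; rewrite lerDr.
Qed.

Lemma le_supnorm s f : local_to s f -> forall e, `|f e| <= supnorm f.
Proof.
move=> fs e; have [C fC] := local_bounded fs.
apply: ub_le_sup; last by exists e.
by exists C => _ [e' _ <-].
Qed.

Fixpoint flips s (a : seq bool) (eta : config d) : config d :=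
  match s, a with
  | x :: s', b :: a' => flip (flips s' a' eta) x b
  | _, _ => eta
  end.

Lemma flips_map s (e eta : config d) x : x \in s -> flips s [seq e y | y <- s] eta x = e x.
Proof.
elim: s => [//|y s IH]; rewrite inE /= /flip; case: eqP => [-> //|_ /=]; exact: IH.
Qed.

Lemma avgs_flips (p : R) s f eta :
  avgs p s f eta = iid_mean (fun b => if b then p else 1 - p) (size s)
    (fun a => f (flips s a eta)).
Proof.
elim: s f => [//|x s IH] f /=.
rewrite -[LHS]/(avgs p s (avg p x f) eta) IH big_bool /= -!iid_meanZ -iid_meanD.
by congr iid_mean.
Qed.

Lemma avgs_norm (p : R) s f C eta : 0 < p < 1 -> (forall e, `|f e| <= C) ->
  `|avgs p s f eta| <= C.
Proof.
move=> p01; elim: s f => [|x s IH] f fC; first exact: fC.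
by apply: (IH (avg p x f)); exact: avg_norm.
Qed.

Lemma map_eq_nth (e : site d -> bool) s a : uniq s -> size s = size a ->
  ([seq e x | x <- s] = a <-> forall x, x \in s -> e x = nth true a (index x s)).
Proof.
move=> us sa; split=> [<- x xs|H].
  by rewrite (nth_map x) ?index_mem // nth_index.
apply: (@eq_from_nth _ true) => [|i]; rewrite size_map // => is_.
case: s us sa H is_ => [//|x0 s] us sa H is_.
by rewrite (nth_map x0) // H ?mem_nth // index_uniq.
Qed.

Lemma measurable_cylinder s (b : site d -> bool) :
  measurable [set e : config d | forall x, x \in s -> e x = b x].
Proof.
rewrite (_ : [set e : config d | _] = \big[setI/setT]_(x <- s) [set e : config d | e x = b x]).
  by apply: bigsetI_measurable => x _; exact: measurable_coordinate.
rewrite -bigcap_seq; apply/seteqP; split => e /= H x; exact: H.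
Qed.

(** Under [mu] the spins along [s] form a word of independent letters, so [integral_iid] applies and
    [avgs] is its mean written one site at a time. *)
Lemma integral_product (p : R) (mu : probability (config d) R) s f eta :
  product_bernoulli p mu -> uniq s -> local_to s f ->
  (\int[mu]_e (f e)%:E = (avgs p s f eta)%:E)%E.
Proof.
move=> mup us fs; pose W (e : config d) := [seq e x | x <- s].
have cylE (a : seq bool) : (size a <= size s)%N ->
    [set e | take (size a) (W e) = a] = [set e : config d | forall x, x \in take (size a) s ->
       e x = nth true a (index x (take (size a) s))].
  move=> as'; apply/seteqP; split => e; rewrite /= /W -map_take;
    by have [] := map_eq_nth e (take_uniq (size a) us) (size_takel as').
rewrite avgs_flips.
have [|a as'|a as'|_ <-] := @integral_iid R bool (fun b => if b then p else 1 - p) _ _ mu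
  (size s) W _ _ _ (fun a => f (flips s a eta)).
- by move=> e; rewrite size_map.
- by rewrite cylE //; exact: measurable_cylinder.
- rewrite cylE // mup ?take_uniq //; congr (_%:E).
  have [_ H] := map_eq_nth (fun x => nth true a (index x (take (size a) s)))
    (take_uniq (size a) us) (size_takel as').
  by rewrite -[in RHS]H // big_map.
- by apply: eq_integral => e _; congr (_%:E); apply: fs => x xs; rewrite flips_map.
Qed.

End CylinderFunctions.

(** * Boxes, and the enumeration of the orthant from the top down *)

Section Boxes.
Variables (R : realType) (d : nat).
Implicit Types (x y z w : site d).

Definition box (L : nat) : seq (site d) :=
  [seq [ffun i => ((u i : nat)%:Z - L%:Z)] | u : {ffun 'I_d -> 'I_(L + L.+1)}].

Lemma mem_box L x : (x \in box L) = [forall i, - L%:Z <= x i <= L%:Z].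
Proof.
apply/mapP/forallP => [[u _ ->] i|H].
  rewrite ffunE; have := ltn_ord (u i); set k := nat_of_ord (u i) => kL.
  by apply/andP; split; lia.
have lt i : (`|(x i + L%:Z)%R| < L + L.+1)%N by have := H i; lia.
exists [ffun i => Ordinal (lt i)]; rewrite ?mem_enum //; apply/ffunP => i; rewrite !ffunE /=.
by rewrite gez0_abs ?addrK //; have := H i; lia.
Qed.

Lemma uniq_box L : uniq (box L).
Proof.
rewrite map_inj_uniq ?enum_uniq // => u v /ffunP uv; apply/ffunP => i.
by apply: val_inj => /=; have := uv i; rewrite !ffunE; lia.
Qed.

Lemma size_box L : size (box L) = ((L + L.+1) ^ d)%N.
Proof. by rewrite size_image card_ffun !card_ord. Qed.

Lemma box_convex L z w x :
  z \in box L -> w \in box L -> lesite z x -> lesite x w -> x \in box L.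
Proof.
rewrite !mem_box => /forallP hz /forallP hw /lesiteP zx /lesiteP xw; apply/forallP => i.
by have := hz i; have := hw i; have := zx i; have := xw i; lia.
Qed.

Lemma coord_dist (z x : site d) i : lesite z x -> x i - (dist z x)%:Z <= z i.
Proof.
move=> /lesiteP zx; rewrite /dist (bigD1 i) //=.
have := zx i; set n := (\sum_(j < d | j != i) _)%N; lia.
Qed.

Lemma box_depth L x : x \in box L -> (forall i, 0 <= x i) -> depth_ge (box L) L x.
Proof.
rewrite mem_box => /forallP xL x0 z zx dzx; rewrite mem_box; apply/forallP => i.
by have := coord_dist i zx; have := xL i; have := x0 i; have /lesiteP/(_ i) := zx; lia.
Qed.

Lemma dist_box (z x : site d) (m n : nat) : (forall i, - m%:Z <= z i) ->
  (forall i, x i <= n%:Z) -> lesite z x -> (dist z x <= d * (m + n))%N.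
Proof.
move=> zm xn /lesiteP zx; rewrite -[d in (d * _)%N]card_ord -sum_nat_const.
by apply: leq_sum => i _; have := zm i; have := xn i; have := zx i; lia.
Qed.

Definition height (x : site d) : int := \sum_i x i.

(** Sorting by decreasing height puts no site before one that lies above it, the order required by
    [word_op_avgs]. *)
Definition orthant_box (n : nat) : seq (site d) :=
  sort (fun x y : site d => height y <= height x)
    [seq x : site d <- box n | (x != [ffun => 0]) && [forall i, 0 <= x i]].

Lemma mem_orthant_box n x : (x \in orthant_box n) =
  (x != [ffun => 0]) && [forall i, 0 <= x i <= n%:Z].
Proof.
rewrite mem_sort mem_filter mem_box -andbA; congr (_ && _).
apply/andP/forallP => [[/forallP h1 /forallP h2] i|h]; first by rewrite h1; case/andP: (h2 i).
by split; apply/forallP => i; case/andP: (h i) => x0 xn //; apply/andP; split; lia.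
Qed.

Lemma orthant_box_sub n L : (n <= L)%N -> {subset orthant_box n <= box L}.
Proof.
move=> nL x; rewrite mem_orthant_box mem_box => /andP[_ /forallP H].
by apply/forallP => i; have := H i; lia.
Qed.

Lemma mem_box_nonpos m L z : (m <= L)%N -> (forall i, - m%:Z <= z i <= 0) -> z \in box L.
Proof. by move=> mL H; rewrite mem_box; apply/forallP => i; have := H i; lia. Qed.

(** Strictness relies on the removal of the origin, which is not strictly above a zero sitting
    there. *)
Lemma ltsite_orthant_box n z x : (forall i, z i <= 0) -> x \in orthant_box n -> ltsite z x.
Proof.
move=> z0; rewrite mem_orthant_box => /andP[x0 /forallP xn].
apply/andP; split; last by apply/lesiteP => i; have := z0 i; have := xn i; lia.
apply: contra x0 => /eqP zx; apply/eqP/ffunP => i; rewrite ffunE.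
by apply/eqP; rewrite eq_le -{1}zx z0; case/andP: (xn i).
Qed.

Lemma size_orthant_box n : (size (orthant_box n) <= (n + n.+1) ^ d)%N.
Proof.
by rewrite size_sort -size_box; exact: size_subseq (filter_subseq _ _).
Qed.

Lemma uniq_orthant_box n : uniq (orthant_box n).
Proof. by rewrite sort_uniq filter_uniq // uniq_box. Qed.

Lemma pairwise_orthant_box n : pairwise (fun x y => ~~ ltsite x y) (orthant_box n).
Proof.
pose r (x y : site d) := height y <= height x.
have tr : transitive r by move=> y x z xy yz; exact: le_trans yz xy.
have tot : total r by move=> x y; exact: le_total.
apply: (@sub_pairwise _ r); last by rewrite -sorted_pairwise // sort_sorted.
move=> x y; rewrite /r => xy; apply/negP => /andP[nxy /lesiteP le].
move/negP: nxy; apply; apply/eqP/ffunP => i; apply/eqP; rewrite eq_le le /=.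
have : height y - height x <= 0 by rewrite subr_le0.
rewrite /height -sumrB (bigD1 i) //= => H.
have : 0 <= \sum_(j < d | j != i) (y j - x j) by apply: sumr_ge0 => j _; rewrite subr_ge0.
by lra.
Qed.

Lemma nat_floor (r : R) : 0 <= r -> exists n : nat, Num.floor r = n%:Z /\ n%:R <= r < n.+1%:R.
Proof.
move=> r0; exists `|Num.floor r|%N.
have f0 : 0 <= Num.floor r by rewrite floor_ge0.
split; first by rewrite gez0_abs.
have := floor_itv r; rewrite intrD /= -[X in X%:~R](gez0_abs f0) -!pmulrn.
by rewrite natr1.
Qed.

End Boxes.

(** * Relaxation to equilibrium *)

(** With $h=(N+1)^{-2}$ a window of about $N$ rows lasts a time of order $1/N$, while the $N$ rings
    allowed per site outnumber the mean, at most $t$. All terms but the taint are then of order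
    $1/N$ for fixed box and $t$. *)
Lemma discretisation_error_le (R : realType) (d : nat) (V s : seq (site d)) (M N D : nat) (t : R) :
  let h : R := (N.+1%:R * N.+1%:R)^-1 in
  let v : R := (size V)%:R in
  M%:R * h <= t ->
  discretisation_error h V M N D s <=
    (v * t + 2 * v + 2 * v * v * (t + 2)) / N.+1%:R +
    (size s)%:R * (2^-1 ^+ D * expR (4 * d%:R * t)).
Proof.
move=> h v Mt; rewrite /discretisation_error -/v.
pose y : R := N.+1%:R^-1.
have n0 : 0 < N.+1%:R :> R by rewrite ltr0n.
have y0 : 0 < y by rewrite invr_gt0.
have y1 : y <= 1 by rewrite invf_le1 // ler1n.
have hE : h = y * y by rewrite /h invfM.
have ny : N.+1%:R * y = 1 by rewrite divff // gt_eqF.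
have v0 : 0 <= v by rewrite ler0n.
have M0 : 0 <= M%:R :> R by rewrite ler0n.
have t0 : 0 <= t by apply: le_trans Mt; rewrite mulr_ge0 // hE mulr_ge0 // ltW.
have N2 : N.+2%:R * h <= 2 * y.
  rewrite hE mulrA ler_pM2r // -natr1 mulrDl ny mul1r; lra.
have MN : (M + N.+2)%:R * h <= t + 2.
  have y2 : 2 * y <= 2 by lra.
  by rewrite natrD mulrDl; lra.
have NN : (N + N.+1)%:R * h <= 2 * y.
  rewrite hE mulrA ler_pM2r // natrD mulrDl ny -[N%:R](addrK 1) natr1 mulrBl ny mul1r; lra.
have h0 : 0 <= h by rewrite hE mulr_ge0 // ltW.
apply: lerD; last first.
  apply: ler_wpM2l; first exact: ler0n.
  apply: ler_wpM2l; first by rewrite exprn_ge0 // invr_ge0.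
  by rewrite ler_expR; apply: ler_wpM2l.
rewrite -/y mulr0 mulr0 add0r [leRHS](_ : _ = v * (t * y) + v * (2 * y) +
  v * (v * ((t + 2) * (2 * y)))); last ring.
apply: lerD; first apply: lerD.
- by apply: ler_wpM2l => //; apply: ler_wpM2r => //; exact: ltW.
- exact: ler_wpM2l.
- apply: ler_wpM2l => //; apply: ler_wpM2l => //.
  rewrite [leLHS](_ : _ = ((M + N.+2)%:R * h) * ((N + N.+1)%:R * h)); last ring.
  by apply: ler_pM => //; rewrite mulr_ge0.
Qed.

Section Relaxation.
Variables (R : realType) (d : nat) (p : R).
Hypothesis p01 : 0 < p < 1.
Variables (T : nat) (b : R).
Hypothesis b1 : 1 < b.
Hypothesis decay : forall (q : R) (V U : seq (site d)), 0 <= q <= 1 ->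
  (forall z w x : site d, z \in V -> w \in V -> lesite z x -> lesite x w -> x \in V) ->
  (forall z : site d, z \in V -> (1 - q) ^+ count_mem z U = expR (-1)) ->
  forall n (x z : site d) (eta : site d -> bool), x \in V -> z \in V -> ltsite z x -> ~~ eta z ->
  word_op p q V (pred1 x) (repeat_word n (repeat_word T U)) (fun=> 1) eta <=
    2^-1 ^+ n * b ^+ dist z x.
Variables (dO : measure_display) (O : measurableType dO) (P : probability O R).
Variables (tau : site d -> nat -> O -> R) (B : site d -> nat -> O -> bool).
Hypothesis indep : mutually_independent P
  (fun j : (site d * nat) + (site d * nat) => match j with
    | inl (x, n) => fun w => ((B x n w : nat)%:R : R)
    | inr (x, n) => tau x n end).
Hypothesis PB : forall x n, P [set w | B x n w] = p%:E.
Hypothesis Ptau : forall x n (s : R), P [set w | tau x n w <= s] =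
  (if s < 0 then 0 else 1 - expR (- s))%:E.
Variables (zeta : config d) (eta : R -> O -> config d).
Hypothesis traj : {ae P, forall w, east_trajectory (fun x n => tau x n w)
  (fun x n => B x n w) zeta (fun t => eta t w)}.
Variable mu : probability (config d) R.
Hypothesis mup : product_bernoulli p mu.
Variables (t : R) (f : config d -> R) (n : nat).
Hypotheses (t0 : 0 <= t) (fn : local_to (orthant_box d n) f).
Hypothesis mt : forall x, measurable_fun setT (fun w => eta t w x).

Let C := supnorm f.
Let s := orthant_box d n.
Let fC : forall e, `|f e| <= C := le_supnorm fn.
Let C0 : 0 <= C. Proof. exact: le_trans (fC zeta). Qed.
Let mf : measurable_fun setT (fun w => f (eta t w)).
Proof. by apply: (measurable_local fn) => x _; exact: mt. Qed.

Lemma mean_diff_le2 :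
  (`| \int[P]_w (f (eta t w))%:E - \int[mu]_e (f e)%:E | <= (2 * C)%:E)%E.
Proof.
rewrite (integral_product zeta mup (uniq_orthant_box d n) fn).
set v := avgs p _ f zeta.
have vE : (\int[P]_w (cst v w)%:E = v%:E)%E.
  by rewrite (integral_cst P measurableT v%:E) [X in (_ * X)%E]probability_setT mule1.
rewrite -[v%:E]vE -[2 * C]mulr1.
apply: (@integral_diff_le _ _ _ P _ _ C 1 setT) => //.
- by move=> w; exact: avgs_norm.
- by split => //; rewrite probability_setT.
- by apply: aeW => w /(_ I).
Qed.

(** The first error is the distance of the discrete chain to equilibrium, a sum of persistence
    probabilities over [s]; the second is the cost of discretisation in a box with margin [k]. *)
Lemma finite_volume_le (m K : nat) (z : site d) (N k : nat) (r0 : R) : (forall i, - m%:Z <= z i <= 0) -> ~~ zeta z ->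
  (K * T)%:R <= t -> (4 * d <= N)%N ->
  let v : R := (size (box d (m + n + k)))%:R in
  (v * t + 2 * v + 2 * v * v * (t + 2)) / N.+1%:R <= r0 ->
  (`| \int[P]_w (f (eta t w))%:E - \int[mu]_e (f e)%:E | <=
    (2 * C * (size s)%:R * (2^-1 ^+ K * b ^+ (d * (m + n))) +
     2 * C * (r0 + (size s)%:R * (2^-1 ^+ k * expR (4 * d%:R * t))))%:E)%E.
Proof.
move=> zm zz KT dN v vN.
pose L := (m + n + k)%N; pose V := box d L.
pose h : R := (N.+1%:R * N.+1%:R)^-1.
have n0 : 0 < N.+1%:R :> R by rewrite ltr0n.
have h0 : 0 < h by rewrite invr_gt0 mulr_gt0.
have [M [_ /andP[]]] := nat_floor (divr_ge0 t0 (ltW h0)).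
rewrite ler_pdivlMr // ltr_pdivrMr // => Mt tM.
have sV : {subset s <= V}.
  by apply: orthant_box_sub; rewrite /L -addnA addnCA leq_addr.
have depth x : x \in s -> depth_ge V L x.
  move=> xs; apply: box_depth; first exact: sV.
  by move=> i; move: xs; rewrite mem_orthant_box => /andP[_ /forallP/(_ i)/andP[]].
have zV : z \in V by apply: mem_box_nonpos zm; rewrite /L -addnA leq_addr.
have hd : 4 * h * d%:R <= 1.
  rewrite mulrAC -ler_pdivlMr // /h div1r invrK -natrM -natrM ler_nat.
  by apply: leq_trans dN _; rewrite (leq_trans (leqnSn N)) // leq_pmulr.
have tMh : M%:R * h <= t < M.+1%:R * h by rewrite Mt tM.
have := mean_word_op p01 h0 indep PB Ptau (uniq_box d L) N sV depth hd C0 fC fn tMh mf traj.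
set W := repeat_word M _; set q := 1 - expR (- h).
have q01 : 0 <= q <= 1.
  by rewrite /q subr_ge0 expR_le1 oppr_le0 ltW //= lerBlDr lerDl expR_ge0.
have avgE := word_op_avgs V p01 q01 W (pairwise_orthant_box d n) fC (local_insensitive fn) zeta.
set EW := word_op _ _ _ _ _ _ _ in avgE *.
rewrite (integral_product zeta mup (uniq_orthant_box d n) fn).
set v0 := avgs _ _ _ _ in avgE *.
have If : (\int[P]_w (f (eta t w))%:E)%E \is a fin_num.
  by apply: integrable_fin_num => //; exact: bounded_integrable mf (fun w => fC _).
rewrite -(fineK If) -!EFinB /= !lee_fin; set a := fine _ => aE.
rewrite (_ : a - v0 = (EW - v0) + (a - EW)); last ring.
apply: le_trans (ler_normD _ _) _; apply: lerD.
  apply: le_trans avgE _; rewrite -[leRHS]mulrA; apply: ler_wpM2l; first by rewrite mulr_ge0.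
  apply: le_trans (_ : \sum_(x <- s) (2^-1 ^+ K * b ^+ (d * (m + n))) <= _); last first.
    by rewrite big_const_seq count_predT iter_addr_0 mulr_natl.
  rewrite big_seq [leRHS]big_seq; apply: ler_sum => x xs.
  have xV := sV x xs; move: (xs); rewrite mem_orthant_box => /andP[x0 /forallP xn].
  have zx : ltsite z x by apply: ltsite_orthant_box xs => i; case/andP: (zm i).
  (* The number of rows in a unit of time, [m1%:R * h = 1], so that [U] is [m1] passes over the box
     and [rho] is [expR (-1)]. *)
  pose m1 := (N.+1 * N.+1)%N.
  have hm : (1 - q) ^+ m1 = expR (-1).
    rewrite /q opprB addrC subrK -expRM_natl mulrN; congr (expR (- _)).
    by rewrite /h /m1 natrM divff // mulf_neq0 // gt_eqF.
  have cU y : y \in V -> (1 - q) ^+ count_mem y (repeat_word m1 V) = expR (-1).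
    by move=> yV; rewrite uniq_repeat_count // uniq_box.
  have KM : (K * (T * m1) <= M)%N.
    rewrite -ltnS -(ltr_nat R); apply: le_lt_trans (_ : (K * T)%:R / h < _).
      by rewrite mulnA [leLHS]natrM /h invrK /m1 [(N.+1 * N.+1)%:R]natrM lexx.
    by rewrite ltr_pdivrMr //; exact: le_lt_trans KT tM.
  (* Only the [K] complete blocks are exploited; the remaining passes are bounded by 1. *)
  have WE : W = repeat_word K (repeat_word T (repeat_word m1 V)) ++
      repeat_word (M - K * (T * m1)) V.
    transitivity (repeat_word (K * (T * m1) + (M - K * (T * m1))) V); first by rewrite subnKC.
    by rewrite !repeat_wordM -?mulnA /repeat_word nseqD flatten_cat.
  rewrite WE word_op_cat; apply: le_trans (word_op_le p01 q01 _ _ _ _) _.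
    by move=> e; exact: (word_op1_le p01 q01).
  apply: le_trans (decay q01 (@box_convex d L) cU K xV zV zx zz) _.
  apply: ler_wpM2l; first by rewrite exprn_ge0 // invr_ge0.
  apply: ler_weXn2l; first exact: ltW.
  apply: dist_box => [i|i|]; [by case/andP: (zm i)|by case/andP: (xn i)|by case/andP: zx].
apply: le_trans aE _; apply: ler_wpM2l; first by rewrite mulr_ge0.
apply: le_trans (discretisation_error_le V s L Mt) _.
apply: lerD => //; apply: ler_wpM2l; first exact: ler0n.
apply: ler_wpM2r; first exact: expR_ge0.
by apply: ler_wiXn2l; rewrite ?invr_ge0 ?invf_le1 ?ler1n //; exact: leq_addl.
Qed.

(** The limit of [finite_volume_le] with $t$ fixed: the margin [k] is chosen against the taint, then
    [N] against the size of the resulting box. *)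
Lemma relaxation (m K : nat) (z : site d) :
  (forall i, - m%:Z <= z i <= 0) -> ~~ zeta z -> (K * T)%:R <= t ->
  (`| \int[P]_w (f (eta t w))%:E - \int[mu]_e (f e)%:E | <=
    (2 * C * (size s)%:R * (2^-1 ^+ K * b ^+ (d * (m + n))))%:E)%E.
Proof.
move=> zm zz KT; apply/lee_addgt0Pr => e e0; rewrite -EFinD.
(* Two errors of size [e'], each multiplied by [2 * C], stay below [e]; adding 1 avoids dividing by
   zero when [f] vanishes. *)
pose e' := e / (4 * (C + 1)).
have C1 : 0 < C + 1 by rewrite ltr_wpDl.
have e'0 : 0 < e' by rewrite divr_gt0 // mulr_gt0.
pose S := (size s)%:R * expR (4 * d%:R * t).
have S0 : 0 <= S by rewrite mulr_ge0 ?expR_ge0.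
have [k kP] : exists k, (2^-1 : R) ^+ k <= e' / (S + 1).
  apply: exists_expr_le; last by rewrite divr_gt0 // ltr_wpDl.
  by rewrite invr_ge0 invf_lt1 ?ltr1n ?ler0n.
set v : R := (size (box d (m + n + k)))%:R.
set c := v * t + 2 * v + 2 * v * v * (t + 2).
have v0 : 0 <= v by rewrite ler0n.
have c0 : 0 <= c by rewrite !addr_ge0 ?mulr_ge0 ?addr_ge0.
have [N0 [_ /andP[_ N0P]]] := nat_floor (divr_ge0 c0 (ltW e'0)).
pose N := (N0 + 4 * d)%N.
apply: le_trans (@finite_volume_le m K z N k e' zm zz KT (leq_addl _ _) _) _.
  rewrite -/v -/c ler_pdivrMr ?ltr0n // mulrC -ler_pdivrMr //.
  by apply: le_trans (ltW N0P) _; rewrite ler_nat ltnS leq_addr.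
rewrite lee_fin lerD2l.
apply: le_trans (_ : 2 * C * (e' + e') <= _).
  apply: ler_wpM2l; first by rewrite mulr_ge0.
  rewrite lerD2l mulrCA -/S; apply: le_trans (ler_wpM2r S0 kP) _.
  rewrite mulrAC ler_pdivrMr ?ltr_wpDl //; apply: ler_wpM2l; first exact: ltW.
  by rewrite lerDl.
rewrite /e' [leLHS](_ : _ = e * (C / (C + 1))); last by field; rewrite gt_eqF.
apply: ler_piMr; first exact: ltW.
by rewrite ler_pdivrMr // mul1r lerDl.
Qed.

End Relaxation.

(** * Choice of the rates and integration over the initial law *)

Lemma le_integral_nonneg (R : realType) (dT : measure_display) (T : measurableType dT)
    (mu : measure T R) (G H : T -> \bar R) :
  (forall x, 0 <= G x)%E -> (forall x, G x <= H x)%E ->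
  (\int[mu]_x G x <= \int[mu]_x H x)%E.
Proof.
(* Both integrals are suprema over nonnegative simple functions lying below the integrand, so
   monotonicity requires no measurability. *)
move=> G0 GH; rewrite !ge0_integralTE //; last by move=> x; exact: le_trans (GH x).
by apply: ereal_sup_le => _ [h hG <-]; exists h => // x; exact: le_trans (GH x).
Qed.

Lemma powR_root_le (R : realType) (d : nat) (t : R) : (0 < d)%N -> 0 <= t ->
  t `^ d%:R^-1 <= 1 + t.
Proof.
move=> d0 t0; have dV0 : 0 <= d%:R^-1 :> R by rewrite invr_ge0.
have [t1|t1] := leP t 1.
  apply: le_trans (_ : 1 `^ d%:R^-1 <= _); first by rewrite ge0_ler_powR ?nnegrE.
  by rewrite powR1 lerDl.
apply: le_trans (_ : t `^ 1 <= _); last by rewrite powRr1 // lerDr.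
by apply: ler_powR; [exact: ltW|rewrite invf_le1 ?ltr0n // ler1n].
Qed.

(** Halving every [T] units of time gives the rate $u=\ln 2/T$. The number of sites and the power of
    [b] may each grow at rate $u/4$, which leaves $u/2$. *)
Lemma decay_rate (R : realType) (d T : nat) (b : R) : (0 < d)%N -> (0 < T)%N -> 1 < b ->
  exists chi c K0 : R, [/\ 0 < chi, 0 < c, 0 < K0 & forall (t : R) (n m K : nat),
    0 <= t -> n%:R <= chi * t `^ d%:R^-1 -> m%:R <= chi * t -> t < K.+1%:R * T%:R ->
    ((n + n.+1) ^ d)%:R * (2^-1 ^+ K * b ^+ (d * (m + n))) <= K0 * expR (- (c * t))].
Proof.
move=> d0 T0 b1; have dR : 0 < d%:R :> R by rewrite ltr0n.
have TR : 0 < T%:R :> R by rewrite ltr0n.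
have lb : 0 < ln b by exact: ln_gt0.
have l2 : 0 < ln 2 :> R by rewrite ln_gt0 // ltr1n.
pose u : R := ln 2 / T%:R; have u0 : 0 < u by rewrite divr_gt0.
(* Since [m + n] is at most $\chi(2t+1)$, this keeps $b^{d(m+n)}$ below a constant times
   $e^{ut/4}$. *)
pose chi := Num.min 1 (u / (8 * d%:R * ln b)).
have dl0 : 0 < 8 * d%:R * ln b by rewrite !mulr_gt0.
have chi0 : 0 < chi by rewrite lt_min ltr01 divr_gt0.
have chi1 : chi <= 1 by rewrite ge_min lexx.
have chiu : 2 * d%:R * chi * ln b <= u / 4.
  have : chi <= u / (8 * d%:R * ln b) by rewrite ge_min lexx orbT.
  by rewrite ler_pdivlMr // => h; lra.
pose v := u / 4; have v0 : 0 < v by rewrite divr_gt0.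
(* Chosen so that $2n+1\le 3+2t\le Q(1+vt/d)$, whose $d$-th power is at most $Q^d e^{vt}$. *)
pose Q := 3 + 2 * d%:R / v.
have Q0 : 0 < Q by rewrite addr_gt0 // !mulr_gt0 ?invr_gt0.
exists chi, (u / 2), (Q ^+ d * (2 * expR (d%:R * chi * ln b))).
split=> //; first by rewrite divr_gt0.
  by rewrite mulr_gt0 ?exprn_gt0 // mulr_gt0 // expR_gt0.
move=> t n m K t0 nt mt tK.
have n_le : n%:R <= chi * (1 + t).
  by apply: le_trans nt _; apply: ler_wpM2l (powR_root_le d0 t0); exact: ltW.
have vt0 : 0 <= v * t / d%:R by rewrite divr_ge0 // mulr_ge0 // ltW.
have card_le : ((n + n.+1) ^ d)%:R <= Q ^+ d * expR (v * t).
  rewrite natrX; apply: le_trans (_ : (Q * (1 + v * t / d%:R)) ^+ d <= _).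
    have rhs0 : 0 <= Q * (1 + v * t / d%:R) by apply: mulr_ge0; [exact: ltW|exact: addr_ge0].
    apply: lerXn2r; rewrite ?nnegrE //.
    rewrite natrD -natr1; apply: le_trans (_ : 3 + 2 * t <= _).
      have : chi * (1 + t) <= 1 + t by rewrite ler_piMl // addr_ge0.
      lra.
    have -> : Q * (1 + v * t / d%:R) = 3 + 2 * t + 3 * (v * t / d%:R) + 2 * d%:R / v.
      by rewrite /Q; field; rewrite !gt_eqF.
    have dv0 : 0 <= 2 * d%:R / v by rewrite divr_ge0 // ltW.
    lra.
  rewrite exprMn ler_wpM2l ?exprn_ge0 ?(ltW Q0) //.
  rewrite [in leRHS](_ : v * t = d%:R * (v * t / d%:R)); last by field; rewrite gt_eqF.
  by rewrite expRM_natl; apply: lerXn2r; rewrite ?nnegrE ?expR_ge0 ?addr_ge0 ?expR_ge1Dx.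
have half_le : (2^-1 : R) ^+ K <= 2 * expR (- (u * t)).
  have -> : 2^-1 = expR (- ln 2) :> R by rewrite expRN lnK // posrE.
  rewrite -expRM_natl -[2 in leRHS]lnK ?posrE // -expRD ler_expR.
  have : t * (ln 2 / T%:R) <= K.+1%:R * T%:R * (ln 2 / T%:R).
    by apply: ler_wpM2r (ltW tK); exact: ltW.
  have -> : K.+1%:R * T%:R * (ln 2 / T%:R) = K.+1%:R * ln 2 :> R by field; rewrite gt_eqF.
  rewrite -/u -natr1 mulrDl mul1r; lra.
have pow_le : b ^+ (d * (m + n)) <= expR (d%:R * chi * ln b) * expR (u / 4 * t).
  rewrite -{1}[b]lnK ?posrE; last exact: lt_trans b1.
  rewrite -expRM_natl -expRD ler_expR natrM natrD.
  have h1 : (m%:R + n%:R) <= chi * t + chi * (1 + t) by exact: lerD.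
  have h2 : d%:R * (m%:R + n%:R) * ln b <= d%:R * (chi * t + chi * (1 + t)) * ln b.
    by apply: ler_wpM2r; [exact: ltW|apply: ler_wpM2l => //; exact: ltW].
  have h3 : 2 * d%:R * chi * ln b * t <= u / 4 * t by exact: ler_wpM2r.
  lra.
apply: le_trans (ler_pM _ _ card_le (ler_pM _ _ half_le pow_le)) _.
- exact: ler0n.
- by rewrite mulr_ge0 // exprn_ge0 // ?invr_ge0 // ltW // (lt_trans _ b1).
- by rewrite exprn_ge0 // invr_ge0.
- by rewrite exprn_ge0 // ltW // (lt_trans _ b1).
rewrite le_eqVlt; apply/orP; left; apply/eqP.
have -> : expR (- (u / 2 * t)) = expR (v * t) * (expR (- (u * t)) * expR (u / 4 * t)).
  by rewrite -!expRD; congr expR; rewrite /v; field.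
ring.
Qed.

Theorem theorem1 (R : realType) (d : nat) (p : R) :
  (1 <= d)%N -> 0 < p < 1 ->
  exists chi : R, 0 < chi /\
  forall nu : probability (config d) R, condition_C nu ->
  exists c1 C1 : R, 0 < c1 /\ 0 < C1 /\
  forall (dO : measure_display) (O : measurableType dO) (P : probability O R)
         (tau : site d -> nat -> O -> R) (B : site d -> nat -> O -> bool)
         (eta : config d -> R -> O -> config d)
         (mu : probability (config d) R),
    (* independent Bernoulli(p) coins and Exp(1) clock increments *)
    mutually_independent P
      (fun j : (site d * nat) + (site d * nat) => match j with
        | inl (x, n) => fun w => ((B x n w : nat)%:R : R)
        | inr (x, n) => tau x n end) ->
    (forall x n, P [set w | B x n w] = p%:E) ->
    (forall x n (s : R), P [set w | tau x n w <= s] =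
        (if s < 0 then 0 else 1 - expR (- s))%:E) ->
    (* eta zeta . w is the East model started from zeta *)
    (forall zeta, {ae P, forall w,
        east_trajectory (fun x n => tau x n w) (fun x n => B x n w)
                        zeta (fun t => eta zeta t w)}) ->
    (forall (t : R) (x : site d),
        measurable_fun setT (fun z : config d * O => eta z.1 t z.2 x)) ->
    product_bernoulli p mu ->
    forall (t : R) (f : config d -> R),
      0 <= t ->
      supp_in f (Lambda (chi * powR t (d%:R^-1))) ->
      (\int[nu]_zeta `| \int[P]_w (f (eta zeta t w))%:E - \int[mu]_z (f z)%:E |
        <= (C1 * supnorm f * expR (- (c1 * t)))%:E)%E.
Proof.
move=> d1 p01.
have rho01 : 0 < (expR (-1) : R) < 1 by rewrite expR_gt0 expR_lt1 oppr_lt0 ltr01.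
have [T [b [T0 b1 decay]]] := survival_decay p01 rho01.
have [chi [c [K0 [chi0 c0 K00 rate]]]] := decay_rate d1 T0 b1.
exists chi; split=> // nu [a [A [a0 [A0 nuA]]]].
(* The rate [a * chi] comes from initial configurations without a zero in a box of side $\chi t$,
   the rate [c] from relaxation started from such a zero. *)
exists (Num.min (a * chi) c), (2 * (A + K0)); split; first by rewrite lt_min c0 mulr_gt0.
split; first by rewrite mulr_gt0 // addr_gt0.
move=> dO O P tau B eta mu indep PB Ptau traj meta mup t f t0 fsupp.
have TR : 0 < T%:R :> R by rewrite ltr0n.
have [n [nE /andP[nr _]]] := nat_floor (mulr_ge0 (ltW chi0) (powR_ge0 t d%:R^-1)).
have [m [mE /andP[mr _]]] := nat_floor (mulr_ge0 (ltW chi0) t0).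
have [K [_ /andP[]]] := nat_floor (divr_ge0 t0 (ltW TR)).
rewrite ler_pdivlMr // ltr_pdivrMr // => Kt tK.
have fn : local_to (orthant_box d n) f.
  move=> e e' ee'; apply: fsupp => x [xr x0]; apply: ee'.
  rewrite mem_orthant_box; apply/andP; split.
    by apply/eqP => xE; apply: x0; rewrite xE.
  by apply/forallP => i; have [h1 h2] := xr i; rewrite h1 -nE.
have C0 : 0 <= supnorm f by apply: le_trans (le_supnorm fn (fun=> true)).
have mt zeta x : measurable_fun setT (fun w => eta zeta t w x).
  exact: (measurableT_comp (meta t x) (pair1_measurable zeta)).
pose bad := [set e : config d | forall x : site d,
  (forall i, (- Num.floor (chi * t) <= x i)%R /\ (x i <= 0)%R) -> e x = true].
pose low := [seq x : site d <- box d m | [forall i, x i <= 0 :> int]].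
have badE : bad = [set e : config d | forall x, x \in low -> e x = xpredT x].
  apply/seteqP; split => e H x.
    rewrite mem_filter mem_box => /andP[/forallP h1 /forallP h2]; apply: H => i.
    by rewrite mE h1; case/andP: (h2 i).
  move=> hx; apply: H; rewrite mem_filter mem_box; apply/andP; split; apply/forallP => i.
    by have [] := hx i.
  by have := hx i; rewrite mE => -[-> h]; apply: le_trans h _.
have mbad : measurable bad by rewrite badE; exact: measurable_cylinder.
set S : R := (size (orthant_box d n))%:R * (2^-1 ^+ K * b ^+ (d * (m + n))).
have S0 : 0 <= S.
  rewrite !mulr_ge0 // exprn_ge0 // ?invr_ge0 //; exact: ltW (lt_trans ltr01 b1).
(* On [bad] the trivial bound [2 * supnorm f] is used, off it [relaxation] started from a zero of
   [zeta] in the box. *)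
have pointwise zeta :
    (`| \int[P]_w (f (eta zeta t w))%:E - \int[mu]_z (f z)%:E | <=
      (2 * supnorm f * \1_bad zeta)%:E + (2 * supnorm f * S)%:E)%E.
  rewrite indicE; case: (pselect (bad zeta)) => bz.
    rewrite mem_set // mulr1; apply: le_trans (mean_diff_le2 p01 P zeta mup fn (mt zeta)) _.
    by rewrite -EFinD lee_fin lerDl mulr_ge0 // mulr_ge0.
  rewrite memNset // mulr0 add0e.
  have [z zm zz] : exists2 z : site d, forall i, - m%:Z <= z i <= 0 & ~~ zeta z.
    apply: contrapT => H; apply: bz => x hx; apply/negPn/negP => zx; apply: H.
    by exists x => // i; have [] := hx i; rewrite mE => -> ->.
  rewrite -natrM in Kt; rewrite /S [X in (_ <= X%:E)%E]mulrA.
  exact: (relaxation p01 b1 (decay d) indep PB Ptau (traj zeta) mup t0 fn (mt zeta) zm zz Kt).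
apply: le_trans (_ : \int[nu]_z ((2 * supnorm f * \1_bad z)%:E + (2 * supnorm f * S)%:E) <= _)%E.
  by apply: le_integral_nonneg => // z; exact: abse_ge0.
have mind : measurable_fun setT (fun z => (2 * supnorm f * \1_bad z)%:E).
  by apply/measurable_EFinP/measurable_funM => //; exact: measurable_indic.
rewrite ge0_integralD //; first last.
- by move=> z _; rewrite lee_fin mulr_ge0 // mulr_ge0.
- by move=> z _; rewrite lee_fin mulr_ge0 // mulr_ge0.
rewrite [X in (_ + X)%E](integral_cst nu measurableT (2 * supnorm f * S)%:E).
rewrite [X in (_ + _ * X)%E]probability_setT mule1.
rewrite (_ : (fun z => _) = (fun z => (2 * supnorm f)%:E * (\1_bad z)%:E)%E); last first.
  by apply/funext => z; rewrite EFinM.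
rewrite ge0_integralZl_EFin ?mulr_ge0 //; last first.
  by apply/measurable_EFinP; exact: measurable_indic.
rewrite integral_indic // setIT.
have nub := nuA (chi * t) (mulr_ge0 (ltW chi0) t0).
apply: le_trans (_ : (2 * supnorm f)%:E * (A * expR (- (a * (chi * t))))%:E +
    (2 * supnorm f * S)%:E <= _)%E.
  by apply: leeD => //; apply: lee_wpmul2l => //; rewrite lee_fin mulr_ge0.
rewrite -EFinM -EFinD lee_fin.
have SK : S <= K0 * expR (- (c * t)).
  apply: le_trans (rate t n m K t0 nr mr tK); apply: ler_wpM2r.
    by rewrite mulr_ge0 // exprn_ge0 // ?invr_ge0 // ltW // (lt_trans ltr01 b1).
  by rewrite ler_nat size_orthant_box.
set c1 := Num.min _ _.
have e1 : expR (- (a * (chi * t))) <= expR (- (c1 * t)).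
  by rewrite ler_expR lerN2 mulrA ler_wpM2r // ge_min lexx.
have e2 : expR (- (c * t)) <= expR (- (c1 * t)).
  by rewrite ler_expR lerN2 ler_wpM2r // ge_min lexx orbT.
rewrite -mulrDr [leRHS](_ : _ = 2 * supnorm f * (A * expR (- (c1 * t)) + K0 * expR (- (c1 * t))));
  last ring.
apply: ler_wpM2l; first by rewrite mulr_ge0.
apply: lerD; first exact: ler_wpM2l (ltW A0) _ _ e1.
by apply: le_trans SK _; exact: ler_wpM2l (ltW K00) _ _ e2.
Qed.
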